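(* Let $\Gamma=\mathbb{Z}_2\wr\mathbb{Z}$ be the lamplighter group and let $\mathcal{X}_2=\{x_1,x_2\}$. There exists a language $L\in\mathbf{B}^{\mathbb{Q}}_{\mathrm{rat}}(\mathcal{X}_2)$ such that $\alpha_L=\frac14\sqrt{\frac27}$. In particular, $\frac14\sqrt{\frac27}\in\mathcal{G}(\Gamma,\mathbb{Q})$.
   Context: Languages and rational series. Let $\mathcal{X}_2^*$ be the free monoid on $\mathcal{X}_2=\{x_1,x_2\}$; a language over $\mathcal{X}_2$ is a subset of $\mathcal{X}_2^*$. Let $d:\mathcal{X}_2^*\to\mathbb{Z}_{\ge 0}$ be the monoid homomorphism with $d(x_i)=i+1$ (so $d(x_1)=2$, $d(x_2)=3$). For a language $L$ put $$\alpha_L=\frac18\sum_{w\in L}\frac{1}{2^{d(w)}}.$$ Let $\mathbb{Q}\langle\langle\mathcal{X}_2\rangle\rangle$ be the algebra of non-commutative formal power series over $\mathbb{Q}$ and $\mathbb{Q}\langle\mathcal{X}_2\rangle$ the subalgebra of non-commutative polynomials. The algebra of rational series $\mathbb{Q}_{\mathrm{rat}}\langle\mathcal{X}_2\rangle$ is the smallest subalgebra of $\mathbb{Q}\langle\langle\mathcal{X}_2\rangle\rangle$ containing $\mathbb{Q}\langle\mathcal{X}_2\rangle$ and closed under inversion of elements invertible in $\mathbb{Q}\langle\langle\mathcal{X}_2\rangle\rangle$. The support of $z=\sum_w\lambda_ww$ is $\{w\mid\lambda_w\ne 0\}$. $\mathbf{B}^{\mathbb{Q}}_{\mathrm{rat}}(\mathcal{X}_2)$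 is the Boolean subalgebra of the power set of $\mathcal{X}_2^*$ generated by the supports of all elements of $\mathbb{Q}_{\mathrm{rat}}\langle\mathcal{X}_2\rangle$. $\ell^2$-Betti numbers. The lamplighter group is $\Gamma=\big(\bigoplus_{i\in\mathbb{Z}}\mathbb{Z}_2\big)\rtimes\mathbb{Z}$, with $\mathbb{Z}$ acting by the Bernoulli shift. The group algebra $\mathbb{Q}\Gamma$ acts on $\ell^2(\Gamma)$ by left multiplication. The group von Neumann algebra $\mathcal{N}(\Gamma)$ is the weak closure of $\mathbb{C}\Gamma$ in the bounded operators on $\ell^2(\Gamma)$, with trace $\mathrm{tr}(S)=\langle S\xi_e,\xi_e\rangle$, $\xi_e$ the indicator function of the identity; on $M_k(\mathcal{N}(\Gamma))$ put $\mathrm{Tr}((S_{ij}))=\sum_i\mathrm{tr}(S_{ii})$. For $A\in M_k(\mathbb{Q}\Gamma)$, $b^{(2)}(A)=\mathrm{Tr}(p_A)$, where $p_A$ is the orthogonal projection of $\ell^2(\Gamma)^k$ onto $\ker A$. $\mathcal{G}(\Gamma,\mathbb{Q})$ is the subgroup of $(\mathbb{R},+)$ generated by all $b^{(2)}(A)$, $A\in M_k(\mathbb{Q}\Gamma)$, $k\ge 1$. *)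

(* Defs.v *)
From HB Require Import structures.
From mathcomp Require Import all_boot all_order all_algebra finmap complex.
From mathcomp Require Import all_classical all_reals all_analysis.

Set Implicit Arguments.
Unset Strict Implicit.
Unset Printing Implicit Defensive.

Import Order.TTheory GRing.Theory Num.Theory.

Local Open Scope classical_set_scope.
Local Open Scope ring_scope.

(* The ordinals 0 and 1 of 'I_2 stand for the letters x_1 and x_2. *)
Definition word := seq 'I_2.

Definition language := set word.

(* The letter x_i has weight i + 1; it is the ordinal of value i - 1, hence
   the double successor. *)
Definition weight (w : word) : nat := \sum_(x <- w) x.+2.

(* All terms are nonnegative, so the sum is taken in [0, +oo]. *)
Definition alpha (R : realType) (L : language) : \bar R :=
  ((8^-1)%:E * \esum_(w in L) (2 ^- weight w)%:E)%E.

Definition ncseries := word -> rat.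

Definition ncs_add (f g : ncseries) : ncseries := fun w => f w + g w.

Definition ncs_scale (c : rat) (f : ncseries) : ncseries := fun w => c * f w.

Definition ncs_one : ncseries := fun w => (w == [::])%:R.

(* Cauchy product: the sum runs over all factorizations w = u ++ v. *)
Definition ncs_mul (f g : ncseries) : ncseries :=
  fun w => \sum_(i < (size w).+1) f (take i w) * g (drop i w).

Definition ncs_support (f : ncseries) : language := [set w | f w != 0].

Definition ncs_polynomial (f : ncseries) : Prop := finite_set (ncs_support f).

Definition ncs_inverse (f g : ncseries) : Prop :=
  ncs_mul f g = ncs_one /\ ncs_mul g f = ncs_one.

Definition ncs_subalgebra (S : set ncseries) : Prop :=
  [/\ S ncs_one,
      forall f g, S f -> S g -> S (ncs_add f g),
      forall c f, S f -> S (ncs_scale c f) &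
      forall f g, S f -> S g -> S (ncs_mul f g)].

Definition inversion_closed (S : set ncseries) : Prop :=
  forall f g, S f -> ncs_inverse f g -> S g.

Definition rational_series : set ncseries :=
  smallest [set S | ncs_subalgebra S /\ inversion_closed S]
    [set f | ncs_polynomial f].

Definition boolean_subalgebra (B : set language) : Prop :=
  [/\ B set0, B setT, setU_closed B, setI_closed B & setC_closed B].

Definition Brat : set language :=
  smallest boolean_subalgebra [set ncs_support f | f in rational_series].

Definition lamps := {fsfun int -> 'Z_2 with 0}.

Definition lamp_add (a b : lamps) : lamps :=
  [fsfun i in (finsupp a `|` finsupp b)%fset => a i + b i].

(* Bernoulli shift: (lamp_shift n a) i = a (i - n). *)
Definition lamp_shift (n : int) (a : lamps) : lamps :=
  [fsfun i in [fset (j + n)%R | j in finsupp a]%fset => a (i - n)].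

Definition lamplighter : Type := (lamps * int)%type.

HB.instance Definition _ := Choice.on lamplighter.

Definition ll_one : lamplighter := ([fsfun], 0).

Definition ll_mul (x y : lamplighter) : lamplighter :=
  (lamp_add x.1 (lamp_shift x.2 y.1), x.2 + y.2).

(* Every element of the direct sum of copies of Z_2 is its own opposite. *)
Definition ll_inv (x : lamplighter) : lamplighter :=
  (lamp_shift (- x.2) x.1, - x.2).

Lemma lamp_addE a b i : lamp_add a b i = a i + b i.
Proof.
rewrite fsfunE in_fsetU.
by case: (finsuppP a); case: (finsuppP b) => //= _ _; rewrite addr0.
Qed.

Lemma lamp_shiftE n a i : lamp_shift n a i = a (i - n).
Proof.
rewrite fsfunE; case: ifPn => // hi; apply/esym/fsfun_dflt.
apply: contra hi => hi; apply/imfsetP; exists (i - n) => //=.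
by rewrite subrK.
Qed.

#[local] Definition llE := (lamp_addE, lamp_shiftE).

Lemma Z2_addxx (z : 'Z_2) : z + z = 0.
Proof. by apply/val_inj; case: z => [[|[|]]]. Qed.

Lemma ll_mulA : associative ll_mul.
Proof.
move=> [a m] [b n] [c p]; rewrite /ll_mul /= addrA; congr pair.
by apply/fsfunP => i; rewrite !llE addrA opprD (addrA i).
Qed.

Lemma ll_mul1 : left_id ll_one ll_mul.
Proof.
move=> [a m]; rewrite /ll_mul /= add0r; congr pair.
by apply/fsfunP => i; rewrite !llE fsfun0E add0r subr0.
Qed.

Lemma ll_mulr1 : right_id ll_one ll_mul.
Proof.
move=> [a m]; rewrite /ll_mul /= addr0; congr pair.
by apply/fsfunP => i; rewrite !llE fsfun0E addr0.
Qed.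

Lemma ll_mulV : left_inverse ll_one ll_inv ll_mul.
Proof.
move=> [a m]; rewrite /ll_mul /= addNr; congr pair.
by apply/fsfunP => i; rewrite !llE fsfun0E Z2_addxx.
Qed.

Lemma ll_mulrV : right_inverse ll_one ll_inv ll_mul.
Proof.
move=> [a m]; rewrite /ll_mul /= subrr; congr pair.
by apply/fsfunP => i; rewrite !llE fsfun0E opprK subrK Z2_addxx.
Qed.

HB.instance Definition _ := isGroup.Build lamplighter
  ll_mulA ll_mul1 ll_mulr1 ll_mulV ll_mulrV.

Section L2Betti.
Variables (R : realType) (G : groupType).

(* Elements of the group algebra over the rationals, as finitely supported
   functions on G. *)
Definition group_algebra := {fsfun G -> rat with 0}.

(* Sum of an absolutely summable family. *)
Definition rsum (f : G -> R) : R :=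
  fine (\esum_(g in setT) (Num.max (f g) 0)%:E)
  - fine (\esum_(g in setT) (Num.max (- f g) 0)%:E).

Definition csum (f : G -> R[i]) : R[i] :=
  Complex (rsum (fun g => complex.Re (f g))) (rsum (fun g => complex.Im (f g))).

Definition in_l2 (u : G -> R[i]) : Prop :=
  (\esum_(g in setT) (Normc.normc (u g) ^+ 2)%:E < +oo)%E.

Definition inner (u v : G -> R[i]) : R[i] :=
  csum (fun g => u g * conjc (v g)).

Definition xi (g : G) : G -> R[i] := fun h => (h == g)%:R.

(* Elements of the Hilbert space of k-tuples are functions v : 'I_k -> G -> C
   all of whose components are square summable. *)
Definition in_l2k k (v : 'I_k -> G -> R[i]) : Prop := forall i, in_l2 (v i).

Definition innerk k (u v : 'I_k -> G -> R[i]) : R[i] :=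
  \sum_(i < k) inner (u i) (v i).

(* Left multiplication: (a u)(g) = \sum_h a(h) u(h^-1 g). *)
Definition ga_act (a : group_algebra) (u : G -> R[i]) : G -> R[i] :=
  fun g => \sum_(h <- finsupp a) ratr (a h) * u (h^-1 * g)%g.

Definition mx_act k (A : 'M[group_algebra]_k) (v : 'I_k -> G -> R[i]) :
  'I_k -> G -> R[i] := fun i g => \sum_(j < k) ga_act (A i j) (v j) g.

Definition l2_ker k (A : 'M[group_algebra]_k) : set ('I_k -> G -> R[i]) :=
  [set v | in_l2k v /\ forall i g, mx_act A v i g = 0].

(* Operators are total functions; their values outside the Hilbert space are
   irrelevant. *)
Definition is_orth_proj k (K : set ('I_k -> G -> R[i]))
    (p : ('I_k -> G -> R[i]) -> ('I_k -> G -> R[i])) : Prop :=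
  forall v, in_l2k v ->
    K (p v) /\
    forall w, K w -> innerk (fun i g => v i g - p v i g) w = 0.

(* The (i, j) entry of an operator on k-tuples. *)
Definition op_entry k (S : ('I_k -> G -> R[i]) -> ('I_k -> G -> R[i]))
    (i j : 'I_k) (u : G -> R[i]) : G -> R[i] :=
  S (fun l => if l == j then u else fun=> 0) i.

Definition vn_tr (S : (G -> R[i]) -> (G -> R[i])) : R[i] :=
  inner (S (xi 1%g)) (xi 1%g).

Definition vn_Tr k (S : ('I_k -> G -> R[i]) -> ('I_k -> G -> R[i])) : R[i] :=
  \sum_(i < k) vn_tr (op_entry S i i).

(* b is the trace of the orthogonal projection onto ker A. This projection
   exists and is unique on the Hilbert space, ker A being closed. *)
Definition is_l2_betti k (A : 'M[group_algebra]_k) (b : R) : Prop :=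
  exists2 p, is_orth_proj (l2_ker A) p & vn_Tr p = (b%:C)%C.

Definition additive_subgroup (H : set R) : Prop :=
  H 0 /\ forall x y, H x -> H y -> H (x - y).

Definition l2_betti_group : set R :=
  smallest additive_subgroup
    [set b | exists k (A : 'M[group_algebra]_k), (0 < k)%N /\ is_l2_betti A b].

End L2Betti.

(* Main.v *)
Require Import Defs.
From mathcomp Require Import all_boot all_order all_algebra finmap complex.
From mathcomp Require Import all_classical all_reals all_analysis.
From mathcomp Require Import ring lra zify.
Import Order.TTheory GRing.Theory Num.Theory.
Import numFieldNormedType.Exports.

Set Implicit Arguments.
Unset Strict Implicit.
Unset Printing Implicit Defensive.

Local Open Scope classical_set_scope.
Local Open Scope ring_scope.

(** Call a word balanced if it has as many letters x_1 as letters x_2.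

    The value. There are C(2n, n) balanced words of length 2n, each of weight 5n,
    so the balanced words have total mass 1/8 times the sum of C(2n, n) / 32^n.
    The generating function of the central binomial coefficients at 1/32 is
    1 / sqrt (1 - 4/32) = sqrt (8/7), and 1/8 sqrt (8/7) = 1/4 sqrt (2/7); see
    [alpha_balanced_value].

    Rationality. Let I = 1 / (1 - x_1 - x_2) be the sum of all words. The product
    I (x_1 - x_2) I is a rational series whose coefficient at w is the difference
    of the two letter counts, so the balanced words are the complement of its
    support; see [balanced_Brat].

    The Betti number. By Fourier transform in the lamps, the Hilbert space becomes
    a space of functions of a configuration in {0,1}^Z and of a site in Z; the
    lamps of the group ring restrict to cylinder sets of configurations, and the
    generator of Z moves the site. A matrix over the group ring is thus a system of
    linear difference equations along Z whose coefficients depend on the bits of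
    the configuration near the site. Encode x_1 by 01, x_2 by 001 and a word w by
    the block 11 enc(w) 1, which occupies weight(w) + 3 bits. The system used here,
    [system], has two unknowns U and C; reading a letter from a 1 to the next 1
    keeps U and adds U or -U to C, the marker 11 at either end of a block forces
    C = 0, and U = C = 0 at every 0 and next to three zeros. A solution is therefore
    supported on blocks, and on the block of w it is (1, balance of the prefix read
    so far), up to a factor, provided that the balance of w is 0; otherwise it
    vanishes. So the kernel has a one-dimensional fibre on every balanced block and
    nothing else, and its von Neumann dimension is the sum of the measures
    2 ^- (weight(w) + 3) of these blocks, which is [alpha] of the balanced words.

    To make this rigorous without a direct integral, cylinder projections are
    treated as the operators [cyl] on functions of the lamps; they amount to right
    multiplications ([rcyl]), hence commute with the matrix. Let q be the projection
    of a basis vector at the identity to the kernel. The diagonal entry of the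
    projection is a value of q, and splitting it over the cylinders that see a
    given block around the site 0 ([dark_value_expansion]) leaves one term for each
    balanced word with a marked cut ([block_value]), up to an error that is
    geometrically small by the Cauchy-Schwarz inequality ([cyl_bound]). Over all
    cuts and both unknowns, the terms of one word are the squared entries of a unit
    vector times the measure of the block, so they add up to that measure
    ([trace_balanced]). The matrix has 12 equations in 2 unknowns and is padded with
    10 zero columns, so that its Betti number is 10 more ([betti_system]); that of
    a zero matrix is 1, and the group generated by both contains the difference. *)

(** * Square summable families *)

Lemma esum_EFinZ (R : realType) (T : choiceType) (S : set T) (c : R) (f : T -> R) :
  0 <= c -> (forall x, 0 <= f x) ->
  (\esum_(x in S) (c * f x)%:E = c%:E * \esum_(x in S) (f x)%:E)%E.
Proof.
move=> c0 f0; rewrite /esum -ereal_supZl//.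
  congr ereal_sup; apply/seteqP; split => [_ [X hX <-]|_ [_ [X hX <-] <-]].
    exists (\sum_(x \in X) (f x)%:E)%E; first by exists X.
    by rewrite ge0_mule_fsumr// => x; rewrite lee_fin.
  by exists X => //; rewrite ge0_mule_fsumr// => x; rewrite lee_fin.
by apply/set0P; exists 0%E; exists set0; [exact: fsets_set0|rewrite fsbig_set0].
Qed.

Section SummableFamilies.
Variables (R : realType) (G : groupType).
Implicit Types (f g : G -> R).

Definition abs_summable f := summable setT (EFin \o f).

Lemma abs_summable_ge0 f : (forall x, 0 <= f x) ->
  (\esum_(x in setT) (f x)%:E < +oo)%E -> abs_summable f.
Proof.
move=> f0; rewrite /abs_summable /summable; congr (_ < _)%E.
by apply: eq_esum => x _; rewrite /= ger0_norm.
Qed.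

Lemma abs_summable_fin f : (forall x, 0 <= f x) -> abs_summable f ->
  (\esum_(x in setT) (f x)%:E \is a fin_num)%E.
Proof.
move=> f0; rewrite /abs_summable summableE; congr (_ \is a fin_num).
by apply: eq_esum => x _; rewrite /= ger0_norm.
Qed.

Lemma abs_summable_le f g :
  (forall x, `|f x| <= g x) -> abs_summable g -> abs_summable f.
Proof.
move=> fg; rewrite /abs_summable /summable; apply: le_lt_trans.
apply: le_esum => x _; rewrite /= lee_fin.
by rewrite (le_trans (fg x))// ler_norm.
Qed.

Lemma abs_summableD f g :
  abs_summable f -> abs_summable g -> abs_summable (fun x => f x + g x).
Proof. exact: summableD. Qed.

Lemma abs_summableN f : abs_summable f -> abs_summable (fun x => - f x).
Proof. by rewrite /abs_summable summableN. Qed.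

Lemma abs_summableZ c f : abs_summable f -> abs_summable (fun x => c * f x).
Proof.
move=> hf; rewrite /abs_summable /summable.
rewrite (_ : (fun _ => _) = (fun x => (`|c| * `|f x|)%:E)); last first.
  by apply/funext => x /=; rewrite normrM.
by rewrite esum_EFinZ//; apply: lte_mul_pinfty.
Qed.

(** A sum of real numbers can be computed from any decomposition into summable
   nonnegative parts; this is what makes [rsum] linear. *)
Lemma rsum_split (p q : G -> R) : (forall x, 0 <= p x) -> (forall x, 0 <= q x) ->
  abs_summable p -> abs_summable q ->
  rsum (fun x => p x - q x) = fine (\esum_(x in setT) (p x)%:E)
                            - fine (\esum_(x in setT) (q x)%:E).
Proof.
move=> p0 q0 sp sq; set f := fun x => p x - q x.
have pos0 x : 0 <= Num.max (f x) 0 by rewrite le_max lexx orbT.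
have neg0 x : 0 <= Num.max (- f x) 0 by rewrite le_max lexx orbT.
have spos : abs_summable (fun x => Num.max (f x) 0).
  apply: abs_summable_le sp => x; rewrite ger0_norm// ge_max p0 andbT /f.
  by rewrite lerBlDr lerDl.
have sneg : abs_summable (fun x => Num.max (- f x) 0).
  apply: abs_summable_le sq => x; rewrite ger0_norm// ge_max q0 andbT /f opprB.
  by rewrite lerBlDr lerDl.
have : (\esum_(x in setT) (p x)%:E + \esum_(x in setT) (Num.max (- f x) 0)%:E =
  \esum_(x in setT) (q x)%:E + \esum_(x in setT) (Num.max (f x) 0)%:E)%E.
  rewrite -!esumD; do ?by move=> x _; rewrite lee_fin.
  apply: eq_esum => x _; rewrite -!EFinD; congr EFin.
  by rewrite /f; case: (leP (p x - q x) 0); case: (leP (- (p x - q x)) 0); lra.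
move: (abs_summable_fin p0 sp) (abs_summable_fin q0 sq).
move: (abs_summable_fin pos0 spos) (abs_summable_fin neg0 sneg).
rewrite /rsum; case: (esum _ _) => // a _; case: (esum _ _) => // b _.
case: (esum _ _) => // c _; case: (esum _ _) => // d _ /=.
by rewrite -!EFinD => -[]; lra.
Qed.

Lemma rsum_ge0E f : (forall x, 0 <= f x) -> abs_summable f ->
  rsum f = fine (\esum_(x in setT) (f x)%:E).
Proof.
move=> f0 sf.
have s0 : abs_summable (fun=> 0).
  by apply: abs_summable_le sf => x; rewrite normr0.
have := @rsum_split f (fun=> 0) f0 (fun=> lexx 0) sf s0.
rewrite [X in rsum X](_ : _ = f); last by apply/funext => x; rewrite subr0.
by move=> ->; rewrite [X in _ - fine X]esum1//= subr0.
Qed.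

Let pos f x := Num.max (f x) 0.
Let neg f x := Num.max (- f x) 0.

Let pos_ge0 f x : 0 <= pos f x. Proof. by rewrite /pos le_max lexx orbT. Qed.
Let neg_ge0 f x : 0 <= neg f x. Proof. by rewrite /neg le_max lexx orbT. Qed.

Let pos_summable f : abs_summable f -> abs_summable (pos f).
Proof.
move=> h; apply: (@abs_summable_le _ (fun x => `|f x|)).
  by move=> x; rewrite ger0_norm// ge_max ler_norm/=.
by rewrite /abs_summable /summable; under eq_esum do rewrite /= normr_id.
Qed.

Let neg_summable f : abs_summable f -> abs_summable (neg f).
Proof. by move/abs_summableN/pos_summable. Qed.

Let posnegE f x : f x = pos f x - neg f x.
Proof. by rewrite /pos /neg; case: (leP (f x) 0); case: (leP (- f x) 0); lra. Qed.

Lemma rsumD f g : abs_summable f -> abs_summable g ->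
  rsum (fun x => f x + g x) = rsum f + rsum g.
Proof.
move=> sf sg.
have -> : (fun x => f x + g x) =
    (fun x => (pos f x + pos g x) - (neg f x + neg g x)).
  by apply/funext => x; rewrite {1}(posnegE f x) {1}(posnegE g x); lra.
rewrite rsum_split; do ?by move=> x; rewrite addr_ge0.
- under eq_esum do rewrite EFinD.
  under [X in _ - fine X]eq_esum do rewrite EFinD.
  rewrite !esumD; do ?by move=> x _; rewrite lee_fin.
  rewrite !fineD; do ?by rewrite abs_summable_fin// ?(pos_summable, neg_summable).
  by rewrite /rsum /pos /neg; lra.
- by apply: abs_summableD; apply: pos_summable.
- by apply: abs_summableD; apply: neg_summable.
Qed.

Lemma rsumN f : rsum (fun x => - f x) = - rsum f.
Proof.
rewrite /rsum opprB; congr (fine _ - fine _).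
by apply: eq_esum => x _; rewrite opprK.
Qed.

Lemma rsumZ c f : abs_summable f -> rsum (fun x => c * f x) = c * rsum f.
Proof.
move=> sf; wlog c0 : c / 0 <= c => [hw|].
  have [c0|c0] := leP 0 c; first exact: hw.
  rewrite -[c]opprK mulNr -hw ?oppr_ge0 1?ltW// -rsumN.
  by congr rsum; apply/funext => x; rewrite !mulNr opprK.
have -> : (fun x => c * f x) = (fun x => c * pos f x - c * neg f x).
  by apply/funext => x; rewrite {1}(posnegE f x) mulrBr.
rewrite rsum_split; do ?by move=> x; rewrite mulr_ge0.
- rewrite !esum_EFinZ// !fineM ?abs_summable_fin ?(pos_summable, neg_summable)//=.
  by rewrite -mulrBr.
- exact/abs_summableZ/pos_summable.
- exact/abs_summableZ/neg_summable.
Qed.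

Lemma rsum0 : rsum ((fun=> 0) : G -> R) = 0.
Proof. by rewrite /rsum !esum1 ?subrr//= => x _; rewrite ?oppr0 maxxx. Qed.

Lemma rsum_reindex (s : G -> G) f :
  set_bij setT setT s -> rsum (f \o s) = rsum f.
Proof.
by move=> hs; rewrite /rsum; congr (fine _ - fine _);
  rewrite [RHS](reindex_esum _ _ _ _ hs).
Qed.

(** A function supported at a single point. *)
Lemma rsum_delta (x0 : G) (c : R) : rsum (fun x => (x == x0)%:R * c) = c.
Proof.
have eq_delta (d : R) : 0 <= d ->
    (\esum_(x in setT) ((x == x0)%:R * d)%:E = d%:E)%E.
  move=> d0; rewrite (esumID [set x0]) => [|x _]; last first.
    by rewrite lee_fin mulr_ge0// ler0n.
  rewrite setTI esum_set1 ?eqxx ?mul1r ?lee_fin// esum1 ?adde0// => x [_ /= h].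
  by case: eqP => [/h|] //; rewrite mul0r.
rewrite /rsum; have dmax (d : R) x : Num.max ((x == x0)%:R * d) 0
   = (x == x0)%:R * Num.max d 0.
  by case: eqP => _; rewrite ?mul1r// !mul0r maxxx.
under eq_esum do rewrite dmax.
under [X in _ - fine X]eq_esum do rewrite -mulrN dmax.
rewrite !eq_delta ?le_max ?lexx ?orbT//=.
by case: (leP c 0); case: (leP (- c) 0); lra.
Qed.

Lemma abs_summable_delta (x0 : G) (c : R) :
  abs_summable (fun x => (x == x0)%:R * c).
Proof.
rewrite /abs_summable /summable (esumID [set x0]) ?esum_ge0//.
rewrite setTI esum_set1// [X in (_ + X)%E]esum1 ?adde0 ?ltry// => x [_ /= h].
by case: eqP => [/h|] //; rewrite mul0r normr0.
Qed.

Definition l2 f := (\esum_(x in setT) (f x ^+ 2)%:E < +oo)%E.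

Lemma l2_sqr f : l2 f -> abs_summable (fun x => f x ^+ 2).
Proof. by apply: abs_summable_ge0 => x; rewrite sqr_ge0. Qed.

Lemma sqr_l2 f : abs_summable (fun x => f x ^+ 2) -> l2 f.
Proof.
rewrite /abs_summable /summable /l2; apply: le_lt_trans.
by apply: le_esum => x _; rewrite lee_fin ler_norm.
Qed.

Lemma l2_mul f g : l2 f -> l2 g -> abs_summable (fun x => f x * g x).
Proof.
move=> /l2_sqr sf /l2_sqr sg; apply: abs_summable_le (abs_summableD sf sg) => x.
rewrite ler_norml; have := sqr_ge0 (f x + g x); have := sqr_ge0 (f x - g x).
have := sqr_ge0 (f x); have := sqr_ge0 (g x).
by rewrite sqrrB sqrrD; set a := f x ^+ 2; set b := g x ^+ 2; lra.
Qed.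

Lemma l2D f g : l2 f -> l2 g -> l2 (fun x => f x + g x).
Proof.
move=> lf lg; apply: sqr_l2; have := abs_summableZ 2 (l2_mul lf lg).
move=> /abs_summableD /(_ (abs_summableD (l2_sqr lf) (l2_sqr lg))).
apply: abs_summable_le => x; rewrite ger0_norm ?sqr_ge0// sqrrD.
by set a := f x ^+ 2; set b := g x ^+ 2; lra.
Qed.

Lemma l2Z c f : l2 f -> l2 (fun x => c * f x).
Proof.
move=> lf; apply: sqr_l2; under eq_fun do rewrite exprMn.
exact/abs_summableZ/l2_sqr.
Qed.

Lemma l2_delta x0 c : l2 (fun x => (x == x0)%:R * c).
Proof.
apply: sqr_l2; apply: abs_summable_le (abs_summable_delta x0 (c ^+ 2)) => x.
by rewrite ger0_norm ?sqr_ge0// exprMn; case: eqP; rewrite ?expr1n ?expr0n.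
Qed.

Lemma l2_reindex (s : G -> G) f : set_bij setT setT s -> l2 f -> l2 (f \o s).
Proof. by move=> hs; rewrite /l2 (reindex_esum _ _ _ _ hs). Qed.

End SummableFamilies.

(** * Orthogonal projections onto pointwise closed subspaces *)

Section HilbertSpace.
Variables (R : realType) (G : groupType) (k : nat).
Local Notation V := ('I_k -> G -> R).
Implicit Types (u v w z : V) (K : set V).

Definition L2 v := forall i, l2 (v i).

Definition dot u v : R := \sum_(i < k) rsum (fun g => u i g * v i g).

Definition lincomb (a b : R) u v : V := fun i g => a * u i g + b * v i g.

Lemma L2_lincomb a b u v : L2 u -> L2 v -> L2 (lincomb a b u v).
Proof. by move=> hu hv i; apply: l2D; apply: l2Z. Qed.

Lemma dotC u v : dot u v = dot v u.
Proof.
by apply: eq_bigr => i _; congr rsum; apply/funext => g; rewrite mulrC.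
Qed.

Lemma dot_lincombl a b u v w : L2 u -> L2 v -> L2 w ->
  dot (lincomb a b u v) w = a * dot u w + b * dot v w.
Proof.
move=> hu hv hw; rewrite /dot !mulr_sumr -big_split/=; apply: eq_bigr => i _.
rewrite -!rsumZ ?l2_mul// -rsumD; try by apply: abs_summableZ; exact: l2_mul.
by congr rsum; apply/funext => g; rewrite /lincomb mulrDl !mulrA.
Qed.

Lemma dot_lincombr a b u v w : L2 u -> L2 v -> L2 w ->
  dot w (lincomb a b u v) = a * dot w u + b * dot w v.
Proof. by move=> *; rewrite ![dot w _]dotC dot_lincombl. Qed.

Lemma dot_sqrE v : L2 v ->
  (dot v v)%:E = (\esum_(g in setT) (\sum_(i < k) v i g ^+ 2)%:E)%E.
Proof.
move=> hv; rewrite /dot -sumEFin.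
under [RHS]eq_esum do rewrite -sumEFin.
rewrite esum_sum => [|g i _ _]; last by rewrite lee_fin sqr_ge0.
apply: eq_bigr => i _.
under eq_fun do rewrite -expr2.
rewrite rsum_ge0E ?fineK ?abs_summable_fin//; try exact: l2_sqr;
  by move=> g; rewrite sqr_ge0.
Qed.

Lemma sum_le_dot v (X : {fset G}) : L2 v ->
  \sum_(g <- X) \sum_(i < k) v i g ^+ 2 <= dot v v.
Proof.
move=> hv; rewrite -lee_fin dot_sqrE//; apply: esum_ge; exists [set` X].
  by split => //; exact: finite_fset.
by rewrite fsbig_finite//= set_fsetK sumEFin.
Qed.

(** Square summability and the norm only depend on finite partial sums, which are
   continuous for pointwise convergence. *)
Lemma L2_bounded v (M : R) :
  (forall X : {fset G}, \sum_(g <- X) \sum_(i < k) v i g ^+ 2 <= M) ->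
  L2 v /\ dot v v <= M.
Proof.
move=> h.
have hsup : (\esum_(g in setT) (\sum_(i < k) v i g ^+ 2)%:E <= M%:E)%E.
  apply: ge_ereal_sup => _ [X [finX _] <-]; rewrite fsbig_finite//= sumEFin.
  by rewrite lee_fin.
have hL : L2 v.
  move=> i; apply: le_lt_trans (le_lt_trans hsup (ltry M)).
  apply: le_esum => g _; rewrite lee_fin (bigD1 i)//= lerDl.
  by apply: sumr_ge0 => j _; exact: sqr_ge0.
by split => //; rewrite -lee_fin dot_sqrE.
Qed.

Lemma dot_ge0 v : L2 v -> 0 <= dot v v.
Proof. by move=> hv; apply: le_trans (sum_le_dot fset0 hv); rewrite big_seq_fset0. Qed.

Lemma sqr_le_dot v i g : L2 v -> v i g ^+ 2 <= dot v v.
Proof.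
move=> hv; apply: le_trans (sum_le_dot [fset g]%fset hv).
rewrite big_seq_fset1 (bigD1 i)//= lerDl.
by apply: sumr_ge0 => j _; exact: sqr_ge0.
Qed.

Lemma dot_eq0 v : L2 v -> dot v v = 0 -> forall i g, v i g = 0.
Proof.
move=> hv h i g; apply/eqP; rewrite -sqrf_eq0 eq_le sqr_ge0 andbT -h.
exact: sqr_le_dot.
Qed.

Definition delta_vec (i0 : 'I_k) (g0 : G) : V :=
  fun i g => (i == i0)%:R * (g == g0)%:R.

Lemma L2_delta i0 g0 : L2 (delta_vec i0 g0).
Proof.
move=> i; rewrite /delta_vec; under eq_fun do rewrite mulrC.
exact: l2_delta.
Qed.

Lemma dot_delta i0 g0 v : dot (delta_vec i0 g0) v = v i0 g0.
Proof.
rewrite /dot (bigD1 i0)//= [X in _ + X]big1 ?addr0 => [|i /negbTE ne].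
  rewrite -[RHS](rsum_delta g0 (v i0 g0)); congr rsum; apply/funext => g.
  by rewrite /delta_vec eqxx mul1r; case: eqP => [->|]; rewrite ?mul0r.
rewrite -[RHS](@rsum0 R G); congr rsum; apply/funext => g.
by rewrite /delta_vec ne !mul0r.
Qed.

(** Closedness is asked for pointwise convergence, which is coarser than norm
   convergence: kernels of matrices over the group algebra satisfy it because every
   coordinate of the image is a finite sum. *)
Definition closed_subspace K :=
  [/\ K `<=` L2, forall a b u v, K u -> K v -> K (lincomb a b u v) &
      forall (vs : nat -> V) v, (forall n, K (vs n)) -> L2 v ->
        (forall i g, vs n i g @[n --> \oo] --> v i g) -> K v].

Lemma parallelogram v w w' : L2 v -> L2 w -> L2 w' ->
  dot (lincomb 1 (-1) w w') (lincomb 1 (-1) w w') =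
  2 * dot (lincomb 1 (-1) v w) (lincomb 1 (-1) v w)
  + 2 * dot (lincomb 1 (-1) v w') (lincomb 1 (-1) v w')
  - 4 * dot (lincomb 1 (-1) v (lincomb (2^-1) (2^-1) w w'))
            (lincomb 1 (-1) v (lincomb (2^-1) (2^-1) w w')).
Proof.
move=> hv hw hw'.
have h1 a b : L2 (lincomb a b w w') by exact: L2_lincomb.
have h2 a b : L2 (lincomb a b v w) by exact: L2_lincomb.
have h3 a b : L2 (lincomb a b v w') by exact: L2_lincomb.
have h4 a b c d : L2 (lincomb a b v (lincomb c d w w')) by exact: L2_lincomb.
rewrite !(dot_lincombl, dot_lincombr)//.
by rewrite (dotC w v) (dotC w' v) (dotC w' w); field.
Qed.

(** The modulus is the one that the parallelogram law gives for a minimizing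
   sequence. *)
Lemma cauchy_modulus_cvg (a : nat -> R) :
  (forall n m, (a n - a m) ^+ 2 <= 2 / n.+1%:R + 2 / m.+1%:R) ->
  exists l : R, a n @[n --> \oo] --> l.
Proof.
move=> ha; suff : cvgn a by move=> h; exists (limn a).
apply/cauchy_cvgP/cauchy_ballP => e e0.
have [N hN] : exists N, forall n, (N <= n)%N -> 2 / n.+1%:R < e ^+ 2 / 2.
  exists (Num.truncn (4 / e ^+ 2)).+1 => n hn.
  have e2 : 0 < e ^+ 2 by rewrite exprn_gt0.
  have : 4 / e ^+ 2 < n.+1%:R.
    apply: lt_le_trans (truncnS_gt _) _; rewrite ler_nat.
    by move: hn; set q := Num.truncn _; lia.
  rewrite ltr_pdivrMr// => h; rewrite ltr_pdivrMr ?ltr0n//.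
  move: h; rewrite (mulrAC (e ^+ 2)) (mulrC _ (e ^+ 2)).
  by set x := e ^+ 2 * _; lra.
rewrite !near_map2; near=> p; rewrite /ball/= -(@ltr_pXn2r _ 2)// ?nnegrE// ?ltW//.
rewrite -normrX ger0_norm ?sqr_ge0//; apply: le_lt_trans (ha _ _) _.
suff [hp1 hp2] : (N <= p.1)%N /\ (N <= p.2)%N.
  by rewrite [ltRHS]splitr ltrD// hN.
by near: p; exists ([set n | N <= n]%N, [set n | N <= n]%N) => /=;
  [split; exists N|case].
Unshelve. all: by end_near. Qed.

Lemma cvg_big_sum (I : Type) (r : seq I) (f : I -> nat -> R) (l : I -> R) :
  (forall i, f i n @[n --> \oo] --> l i) ->
  \sum_(i <- r) f i n @[n --> \oo] --> \sum_(i <- r) l i.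
Proof.
move=> h; elim: r => [|i r IH].
  by rewrite big_nil; under eq_fun do rewrite big_nil; exact: cvg_cst.
by rewrite big_cons; under eq_fun do rewrite big_cons; exact: cvgD.
Qed.

(** A minimizing sequence is Cauchy by the parallelogram law, and its pointwise
   limit attains the distance because finite partial sums of squares are
   continuous. *)
Lemma nearest_point K v : closed_subspace K -> K (fun _ _ => 0) -> L2 v ->
  exists2 w, K w & forall w', K w' ->
    dot (lincomb 1 (-1) v w) (lincomb 1 (-1) v w) <=
    dot (lincomb 1 (-1) v w') (lincomb 1 (-1) v w').
Proof.
move=> [KL Klin Kcl] K0 hv.
pose dist w := dot (lincomb 1 (-1) v w) (lincomb 1 (-1) v w).
have hsub w : K w -> L2 (lincomb 1 (-1) v w) by move=> /KL ?; exact: L2_lincomb.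
pose m := inf [set dist w | w in K].
have hinf : has_inf [set dist w | w in K].
  split; first by exists (dist (fun _ _ => 0)); exists (fun _ _ => 0).
  by exists 0 => _ [w Kw <-]; apply: dot_ge0; exact: hsub.
have hm w : K w -> m <= dist w.
  by move=> Kw; apply: ge_inf; [case: hinf|exists w].
have hseq n : exists w, K w /\ dist w < m + n.+1%:R^-1.
  have /(inf_adherent (E := [set dist w | w in K]))/(_ hinf) :
    0 < n.+1%:R^-1 :> R by rewrite invr_gt0 ltr0n.
  by case=> _ [w Kw <-] h; exists w.
have [ws hws] := choice hseq.
have hK n : K (ws n) by have [] := hws n.
have hd n : dist (ws n) < m + n.+1%:R^-1 by have [] := hws n.
have hcauchy i g n p :
    (ws n i g - ws p i g) ^+ 2 <= 2 / n.+1%:R + 2 / p.+1%:R.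
  have hL : L2 (lincomb 1 (-1) (ws n) (ws p)) by apply: L2_lincomb; exact: KL.
  have := sqr_le_dot i g hL; rewrite {1}/lincomb mul1r mulN1r => /le_trans; apply.
  rewrite (parallelogram hv (KL _ (hK n)) (KL _ (hK p))).
  have := hm _ (Klin 2^-1 2^-1 _ _ (hK n) (hK p)).
  have := hd n; have := hd p; rewrite /dist.
  by set a := n.+1%:R^-1; set b := p.+1%:R^-1; set x := dot _ _; set y := dot _ _;
    set t := dot _ _; lra.
have hlim i : exists wi : G -> R, forall g, ws n i g @[n --> \oo] --> wi g.
  have hg g : exists l : R, ws n i g @[n --> \oo] --> l.
    by apply: cauchy_modulus_cvg => n p.
  by have [wi hwi] := choice hg; exists wi.
have [w hw] := choice hlim.
have hbd (X : {fset G}) :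
    \sum_(g <- X) \sum_(i < k) (lincomb 1 (-1) v w i g) ^+ 2 <= m.
  have cvgX : \sum_(g <- X) \sum_(i < k) (lincomb 1 (-1) v (ws n) i g) ^+ 2
      @[n --> \oo] --> \sum_(g <- X) \sum_(i < k) (lincomb 1 (-1) v w i g) ^+ 2.
    apply: cvg_big_sum => g; apply: cvg_big_sum => i.
    under eq_fun do rewrite expr2; rewrite expr2 /lincomb.
    by apply: cvgM; (apply: cvgD; [exact: cvg_cst|apply: cvgM => //;
      exact: cvg_cst]).
  have cvgm : m + n.+1%:R^-1 @[n --> \oo] --> m.
    by rewrite -[X in _ --> X]addr0; apply: cvgD;
      [exact: cvg_cst|exact: cvg_harmonic].
  apply: (ler_cvg_to cvgX cvgm); apply: nearW => n.
  exact: le_trans (sum_le_dot X (hsub _ (hK n))) (ltW (hd n)).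
have [hL hdist] := L2_bounded hbd.
have hwL : L2 w.
  have := L2_lincomb 1 (-1) hv hL.
  have -> // : lincomb 1 (-1) v (lincomb 1 (-1) v w) = w.
  by apply/funext => i; apply/funext => g; rewrite /lincomb; lra.
exists w; first exact: (Kcl ws).
by move=> w' /hm; apply: le_trans.
Qed.

(** First variation of the squared distance at the nearest point. *)
Theorem orthogonal_projection K v :
  closed_subspace K -> K (fun _ _ => 0) -> L2 v ->
  exists2 w, K w & forall z, K z -> dot (lincomb 1 (-1) v w) z = 0.
Proof.
move=> hK K0 hv; have [w Kw hmin] := nearest_point hK K0 hv.
have [KL Klin _] := hK.
have hL : L2 (lincomb 1 (-1) v w) by apply: L2_lincomb => //; exact: KL.
exists w => // z Kz; have zL := KL _ Kz.
have : forall t, dot (lincomb 1 (-1) v w) (lincomb 1 (-1) v w) <=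
    dot (lincomb 1 (- t) (lincomb 1 (-1) v w) z)
        (lincomb 1 (- t) (lincomb 1 (-1) v w) z).
  move=> t; have := hmin _ (Klin 1 t _ _ Kw Kz).
  have -> // : lincomb 1 (-1) v (lincomb 1 t w z)
          = lincomb 1 (- t) (lincomb 1 (-1) v w) z.
  by apply/funext => i; apply/funext => g; rewrite /lincomb; lra.
move: (lincomb 1 (-1) v w) hL => d dL hd; set a := dot d z; set b := dot z z.
have b0 : 0 <= b by exact: dot_ge0.
have key t : 0 <= - 2 * t * a + t ^+ 2 * b.
  have hdz : L2 (lincomb 1 (- t) d z) by exact: L2_lincomb.
  have := hd t; rewrite dot_lincombl// dot_lincombr// dot_lincombr//.
  by rewrite (dotC z d) -/a -/b; lra.
(* The optimal variation is a / b; adding 1 avoids dividing by 0 when z = 0. *)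
have := key (a / (b + 1)).
have b1 : 0 < b + 1 by lra.
rewrite (_ : - 2 * _ * _ + _ = - (a ^+ 2 * (b + 2)) / (b + 1) ^+ 2); last first.
  by field; rewrite gt_eqF.
rewrite pmulr_lge0 ?invr_gt0 ?exprn_gt0// oppr_ge0.
rewrite pmulr_lle0; last lra.
by move=> h; apply/eqP; rewrite -sqrf_eq0 eq_le h sqr_ge0.
Qed.

End HilbertSpace.

(** * Betti numbers from real kernels *)

Section RealKernel.
Variables (R : realType) (G : groupType) (k : nat).
Local Notation V := ('I_k -> G -> R).
Local Notation VC := ('I_k -> G -> R[i]).

Definition ga_act_real (a : group_algebra G) (u : G -> R) : G -> R :=
  fun g => \sum_(h <- finsupp a) ratr (a h) * u (h^-1 * g)%g.

Definition real_ker (A : 'M[group_algebra G]_k) : set V :=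
  [set v | L2 v /\ forall i g, \sum_(j < k) ga_act_real (A i j) (v j) g = 0].

Lemma real_ker_closed A : closed_subspace (real_ker A).
Proof.
split=> [v []//|a b u v [Lu hu] [Lv hv]|vs v hvs Lv lim].
- split=> [|i g]; first exact: L2_lincomb.
  rewrite -[RHS](addr0 0) -[in X in _ = X + _](mulr0 a) -[in X in _ = _ + X](mulr0 b).
  rewrite -[in X in _ = X + _](hu i g) -[in X in _ = _ + X](hv i g).
  rewrite !mulr_sumr -big_split/=; apply: eq_bigr => j _.
  rewrite /ga_act_real !mulr_sumr -big_split/=; apply: eq_bigr => h _.
  by rewrite /lincomb; ring.
- split=> // i g.
  have cv : \sum_(j < k) ga_act_real (A i j) (vs n j) g @[n --> \oo] -->
      \sum_(j < k) ga_act_real (A i j) (v j) g.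
    apply: cvg_big_sum => j; apply: cvg_big_sum => h.
    by apply: cvgM => //; exact: cvg_cst.
  have : \sum_(j < k) ga_act_real (A i j) (vs n j) g @[n --> \oo] --> (0 : R).
    rewrite (_ : (fun n => _) = fun=> 0); first exact: cvg_cst.
    by apply/funext => n; case: (hvs n).
  by apply: cvg_unique.
Qed.

Lemma real_ker0 A : real_ker A (fun _ _ => 0).
Proof.
split=> [i|i g]; first by rewrite /l2 esum1 ?ltry// => g _; rewrite expr0n.
by rewrite big1// => j _; rewrite /ga_act_real big1// => h _; rewrite mulr0.
Qed.

Definition re_vec (v : VC) : V := fun i g => complex.Re (v i g).
Definition im_vec (v : VC) : V := fun i g => complex.Im (v i g).

Lemma Re_sum (I : Type) (r : seq I) (F : I -> R[i]) :
  complex.Re (\sum_(i <- r) F i) = \sum_(i <- r) complex.Re (F i).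
Proof. by elim/big_rec2: _ => // i x y _ <-; case: (F i) => ? ?; case: y. Qed.

Lemma Im_sum (I : Type) (r : seq I) (F : I -> R[i]) :
  complex.Im (\sum_(i <- r) F i) = \sum_(i <- r) complex.Im (F i).
Proof. by elim/big_rec2: _ => // i x y _ <-; case: (F i) => ? ?; case: y. Qed.

Lemma ratr_complex (q : rat) : ratr q = Complex (ratr q) 0 :> R[i].
Proof. by rewrite -[RHS]/(real_complex R (ratr q)) fmorph_rat. Qed.

Lemma re_mx_act (A : 'M[group_algebra G]_k) v i g :
  complex.Re (mx_act A v i g) = \sum_(j < k) ga_act_real (A i j) (re_vec v j) g.
Proof.
rewrite Re_sum; apply: eq_bigr => j _; rewrite Re_sum; apply: eq_bigr => h _.
by rewrite ratr_complex /re_vec; case: (v j _) => a b /=; rewrite mul0r subr0.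
Qed.

Lemma im_mx_act (A : 'M[group_algebra G]_k) v i g :
  complex.Im (mx_act A v i g) = \sum_(j < k) ga_act_real (A i j) (im_vec v j) g.
Proof.
rewrite Im_sum; apply: eq_bigr => j _; rewrite Im_sum; apply: eq_bigr => h _.
by rewrite ratr_complex /im_vec; case: (v j _) => a b /=; rewrite mul0r addr0.
Qed.

Lemma normc_sqr (z : R[i]) :
  Normc.normc z ^+ 2 = complex.Re z ^+ 2 + complex.Im z ^+ 2.
Proof. by case: z => a b; rewrite /= sqr_sqrtr// addr_ge0 ?sqr_ge0. Qed.

Lemma in_l2kP v : in_l2k v <-> L2 (re_vec v) /\ L2 (im_vec v).
Proof.
split=> [h|[hr hi] i].
  by split=> i; apply: le_lt_trans (h i); apply: le_esum => g _;
    rewrite lee_fin normc_sqr (lerDl, lerDr) sqr_ge0.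
rewrite /in_l2; under eq_esum do rewrite normc_sqr EFinD.
rewrite esumD; try by move=> g _; rewrite lee_fin sqr_ge0.
by rewrite lte_add_pinfty//; [exact: hr|exact: hi].
Qed.

Lemma l2_kerP A v : l2_ker A v <-> real_ker A (re_vec v) /\ real_ker A (im_vec v).
Proof.
split=> [[/in_l2kP[hr hi] h]|[[hr r0] [hi i0]]].
  by split; split=> // i g; rewrite -(re_mx_act, im_mx_act) h.
split=> [|i g]; first exact/in_l2kP.
by apply/eqP; rewrite eq_complex re_mx_act im_mx_act r0 i0 !eqxx.
Qed.

Lemma sum_Complex (F F' : 'I_k -> R) :
  \sum_i Complex (F i) (F' i) = Complex (\sum_i F i) (\sum_i F' i).
Proof.
by apply/eqP; rewrite eq_complex Re_sum Im_sum !eqxx.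
Qed.

Lemma innerkE u v : in_l2k u -> in_l2k v -> innerk u v =
  Complex (dot (re_vec u) (re_vec v) + dot (im_vec u) (im_vec v))
          (dot (im_vec u) (re_vec v) - dot (re_vec u) (im_vec v)).
Proof.
move=> /in_l2kP[ur ui] /in_l2kP[vr vi].
rewrite /innerk /inner /csum sum_Complex /dot -sumrB -big_split/=.
congr Complex; apply: eq_bigr => i _.
  rewrite -rsumD; [|exact: l2_mul..].
  congr rsum; apply/funext => g; rewrite /re_vec /im_vec.
  by case: (u i g) => a b; case: (v i g) => c d /=; ring.
rewrite -rsumN -rsumD; [|exact: l2_mul|exact/abs_summableN/l2_mul].
congr rsum; apply/funext => g; rewrite /re_vec /im_vec.
by case: (u i g) => a b; case: (v i g) => c d /=; ring.
Qed.

(** The projection onto the complex kernel acts separately on real and imaginary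
   parts, the matrix being rational; hence its trace only involves the
   projections [q i] of the basis vectors at the identity. *)
Theorem l2_betti_real A : exists q : 'I_k -> V,
  [/\ forall i, real_ker A (q i),
      forall i z, real_ker A z -> dot (q i) z = z i 1%g &
      is_l2_betti A (\sum_(i < k) q i i 1%g)].
Proof.
have /choice[p hp] : forall v : V, exists w, L2 v ->
    real_ker A w /\ forall z, real_ker A z -> dot (lincomb 1 (-1) v w) z = 0.
  move=> v; have [Lv|nLv] := pselect (L2 v); last by exists v.
  have [w Kw hw] := orthogonal_projection (real_ker_closed A) (real_ker0 A) Lv.
  by exists w.
pose e (i : 'I_k) : V := delta_vec R i 1%g.
have Le i : L2 (e i) by exact: L2_delta.
have KL z : real_ker A z -> L2 z by case.
exists (fun i => p (e i)); split=> [i|i z Kz|].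
- by have [] := hp _ (Le i).
- have [Kp /(_ z Kz)] := hp _ (Le i).
  rewrite dot_lincombl ?mul1r ?mulN1r ?dot_delta//; try exact: KL.
  by move/eqP; rewrite subr_eq0 => /eqP.
pose pC (v : VC) : VC := fun i g => Complex (p (re_vec v) i g) (p (im_vec v) i g).
have re_pC v : re_vec (pC v) = p (re_vec v) by [].
have im_pC v : im_vec (pC v) = p (im_vec v) by [].
exists pC => [v hv|].
  have /in_l2kP[Lr Li] := hv.
  have [[Kr hr] [Ki hi]] := (hp _ Lr, hp _ Li).
  have Kp : l2_ker A (pC v) by apply/l2_kerP.
  split=> // w /[dup] Kw /l2_kerP[Kwr Kwi].
  pose d : VC := fun i g => v i g - pC v i g.
  have dr : re_vec d = lincomb 1 (-1) (re_vec v) (p (re_vec v)).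
    apply/funext => i; apply/funext => g; rewrite /lincomb /d /re_vec /pC.
    by case: (v i g) => a b /=; rewrite mul1r mulN1r.
  have di : im_vec d = lincomb 1 (-1) (im_vec v) (p (im_vec v)).
    apply/funext => i; apply/funext => g; rewrite /lincomb /d /im_vec /pC.
    by case: (v i g) => a b /=; rewrite mul1r mulN1r.
  rewrite -/d innerkE; last by case: Kw.
    by rewrite dr di !(hr, hi)// !(addr0, subr0).
  by apply/in_l2kP; rewrite dr di; split; apply: L2_lincomb => //; exact: KL.
rewrite /vn_Tr (eq_bigr (fun i => Complex (p (e i) i 1%g) 0)) => [|i _].
  by rewrite sum_Complex; congr Complex; rewrite big1.
have pxi : re_vec (fun l => if l == i then xi R (1%g : G) else fun=> 0) = e i.
  apply/funext => j; apply/funext => g; rewrite /re_vec /e /delta_vec /xi.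
  by case: eqP => _; rewrite ?mul1r ?mul0r//; case: eqP.
have pxi0 : im_vec (fun l => if l == i then xi R (1%g : G) else fun=> 0) =
    (fun _ _ => 0).
  apply/funext => j; apply/funext => g; rewrite /im_vec /xi.
  by case: eqP => _ //; case: eqP.
have p0 j g : p (fun _ _ => 0) j g = 0.
  have L0 := KL _ (real_ker0 A); have [Kp hp0] := hp _ L0.
  apply: (dot_eq0 (KL _ Kp)); have := hp0 _ Kp.
  rewrite dot_lincombl//; try exact: KL.
  rewrite {1}/dot big1 ?mulr0 ?add0r ?mulN1r => [/eqP|l _].
    by rewrite oppr_eq0 => /eqP.
  by under eq_fun do rewrite mul0r; exact: rsum0.
rewrite /vn_tr /inner /op_entry /csum /xi.
congr Complex; [rewrite -[RHS](rsum_delta (1%g : G))|rewrite -[RHS](rsum0 R G)];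
  congr rsum; apply/funext => g; rewrite /pC pxi pxi0 p0;
  by case: eqP => [->|_] /=; rewrite ?(mul0r, mulr0, mul1r, mulr1, oppr0, subr0, addr0).
Qed.

End RealKernel.

(** * Cylinder projections *)

Section Lamps.

Definition lamp (j : int) : lamps := [fsfun i in [fset j]%fset => 1].

Lemma lampE j i : lamp j i = (i == j)%:R.
Proof. by rewrite fsfunE inE; case: eqP. Qed.

Lemma lamp_addC a b : lamp_add a b = lamp_add b a.
Proof. by apply/fsfunP => i; rewrite !lamp_addE addrC. Qed.

Lemma lamp_addA a b c : lamp_add a (lamp_add b c) = lamp_add (lamp_add a b) c.
Proof. by apply/fsfunP => i; rewrite !lamp_addE addrA. Qed.

Lemma lamp_addK j a : lamp_add (lamp j) (lamp_add (lamp j) a) = a.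
Proof. by apply/fsfunP => i; rewrite !lamp_addE addrA Z2_addxx add0r. Qed.

Lemma lamp_addCA a b c : lamp_add a (lamp_add b c) = lamp_add b (lamp_add a c).
Proof. by rewrite !lamp_addA (lamp_addC a). Qed.

End Lamps.

Section Cylinders.
Variable R : realType.
Implicit Types (f g h : lamps -> R) (b c : bool) (i j s : int) (bs cs : seq bool).

(** Under the Fourier transform of the group of lamps, [proj j b] is the
   restriction to the configurations x in the dual group (a product of copies of
   Z/2 indexed by the integers) that satisfy x_j = b. *)
Definition proj j b h : lamps -> R :=
  fun a => (h a + (-1) ^+ b * h (lamp_add (lamp j) a)) / 2.

Fixpoint cyl s bs h : lamps -> R :=
  if bs is b :: bs' then proj s b (cyl (s + 1) bs' h) else h.

Lemma projC i j b c h : proj i b (proj j c h) = proj j c (proj i b h).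
Proof.
by apply/funext => a; rewrite /proj lamp_addCA; ring.
Qed.

Lemma proj_id j b h : proj j b (proj j b h) = proj j b h.
Proof.
by apply/funext => a; rewrite /proj lamp_addK; case: b => /=; field.
Qed.

Lemma proj_orth j b h : proj j b (proj j (~~ b) h) = fun=> 0.
Proof.
by apply/funext => a; rewrite /proj lamp_addK; case: b => /=; field.
Qed.

Lemma proj_split j h a : h a = proj j true h a + proj j false h a.
Proof. by rewrite /proj /=; field. Qed.

Lemma proj_lin j b (x y : R) f g :
  proj j b (fun a => x * f a + y * g a) =
  fun a => x * proj j b f a + y * proj j b g a.
Proof. by apply/funext => a; rewrite /proj; ring. Qed.

Lemma cyl_lin s bs (x y : R) f g :
  cyl s bs (fun a => x * f a + y * g a) =
  fun a => x * cyl s bs f a + y * cyl s bs g a.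
Proof. by elim: bs s => //= b bs IH s; rewrite IH proj_lin. Qed.

Lemma cyl0 s bs : cyl s bs (fun=> 0) = fun=> 0.
Proof.
elim: bs s => //= b bs IH s; rewrite IH.
by apply/funext => a; rewrite /proj mulr0 addr0 mul0r.
Qed.

Lemma cylZ s bs (x : R) f : cyl s bs (fun a => x * f a) = fun a => x * cyl s bs f a.
Proof.
have := cyl_lin s bs x 0 f f; under eq_fun do rewrite mul0r addr0.
by move=> ->; apply/funext => a; rewrite mul0r addr0.
Qed.

Lemma cylD s bs f g :
  cyl s bs (fun a => f a + g a) = fun a => cyl s bs f a + cyl s bs g a.
Proof.
have := cyl_lin s bs 1 1 f g; under eq_fun do rewrite !mul1r.
by move=> ->; apply/funext => a; rewrite !mul1r.
Qed.

Lemma cylB s bs f g :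
  cyl s bs (fun a => f a - g a) = fun a => cyl s bs f a - cyl s bs g a.
Proof.
have := cyl_lin s bs 1 (-1) f g; under eq_fun do rewrite mul1r mulN1r.
by move=> ->; apply/funext => a; rewrite mul1r mulN1r.
Qed.

Lemma cyl_sum (I : Type) (r : seq I) s bs (F : I -> lamps -> R) :
  cyl s bs (fun a => \sum_(i <- r) F i a) = fun a => \sum_(i <- r) cyl s bs (F i) a.
Proof.
elim: r => [|i r IH].
  under eq_fun do rewrite big_nil; rewrite cyl0.
  by apply/funext => a; rewrite big_nil.
under eq_fun do rewrite big_cons; rewrite cylD IH.
by apply/funext => a; rewrite big_cons.
Qed.

Lemma cyl_cat s bs cs h :
  cyl s (bs ++ cs) h = cyl s bs (cyl (s + (size bs)%:Z) cs h).
Proof.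
elim: bs s => [|b bs IH] s /=; first by rewrite addr0.
by rewrite IH -addrA.
Qed.

Lemma cyl_projC s bs j b h : cyl s bs (proj j b h) = proj j b (cyl s bs h).
Proof. by elim: bs s => //= c bs IH s; rewrite IH projC. Qed.

Lemma cylC s bs t cs h : cyl s bs (cyl t cs h) = cyl t cs (cyl s bs h).
Proof. by elim: cs t => //= c cs IH t; rewrite cyl_projC IH. Qed.

Lemma cyl_id s bs h : cyl s bs (cyl s bs h) = cyl s bs h.
Proof. by elim: bs s h => //= b bs IH s h; rewrite cyl_projC IH proj_id. Qed.

(** Identities on a cylinder persist on every smaller cylinder. *)
Lemma cyl_sub s pre mid post t f g : t = s + (size pre)%:Z ->
  cyl t mid f = cyl t mid g ->
  cyl s (pre ++ mid ++ post) f = cyl s (pre ++ mid ++ post) g.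
Proof.
move=> -> h; rewrite !cyl_cat.
by rewrite [X in cyl s pre X]cylC [RHS](congr1 (cyl s pre) (cylC _ _ _ _ _)) h.
Qed.

Arguments cyl_sub {s} pre {mid} post {t f g}.

Lemma cyl_rcons s bs h a :
  cyl s bs h a = cyl s (rcons bs true) h a + cyl s (rcons bs false) h a.
Proof.
rewrite -!cats1 !cyl_cat /= !cyl_projC; exact: proj_split.
Qed.

Lemma cyl_cons s bs h a :
  cyl s bs h a = cyl (s - 1) (true :: bs) h a + cyl (s - 1) (false :: bs) h a.
Proof. by rewrite /= subrK; exact: proj_split. Qed.

Lemma cyl_conflict_cat s p1 q1 t p2 q2 b h :
  s + (size p1)%:Z = t + (size p2)%:Z ->
  cyl s (p1 ++ b :: q1) (cyl t (p2 ++ ~~ b :: q2) h) = fun=> 0.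
Proof.
move=> e; rewrite cyl_cat [cyl t _ _]cyl_cat /= e.
by rewrite [cyl t p2 _]cyl_projC [cyl (_ + 1) q1 _]cyl_projC proj_orth cyl0.
Qed.

(** Disjoint sets of configurations have orthogonal projections. *)
Lemma cyl_conflict s bs t cs h (m n : nat) : (m < size bs)%N -> (n < size cs)%N ->
  s + m%:Z = t + n%:Z -> nth false bs m != nth false cs n ->
  cyl s bs (cyl t cs h) = fun=> 0.
Proof.
move=> hm hn e ne.
have e' : s + (size (take m bs))%:Z = t + (size (take n cs))%:Z.
  by rewrite !size_takel// ltnW.
have cE : nth false cs n = ~~ nth false bs m.
  by case: (nth false bs m) ne; case: nth.
have := cyl_conflict_cat (drop m.+1 bs) (drop n.+1 cs) (nth false bs m) h e'.
by rewrite -cE -!drop_nth// !cat_take_drop.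
Qed.

Definition dark : lamps := [fsfun].

Lemma darkE i : dark i = 0. Proof. by rewrite fsfun0E. Qed.

Definition at_dark : lamps -> R := fun a => (a == dark)%:R.

(** Projections at sites beyond [j] do not flip the lamp [j]. *)
Lemma cyl_support s bs h j (a : lamps) :
  (forall a' : lamps, a' j != 0 -> h a' = 0) -> j < s ->
  a j != 0 -> cyl s bs h a = 0.
Proof.
elim: bs s a => [|b bs IH] s a hh js aj /=; first exact: hh.
have js' : j < s + 1 by rewrite (lt_trans js)// ltrDl.
have aj' : lamp_add (lamp s) a j != 0.
  by rewrite lamp_addE lampE (lt_eqF js) mulr0n add0r.
by rewrite /proj !IH// mulr0 addr0 mul0r.
Qed.

(** The diagonal entry of the projection is the measure of the cylinder: each bit
   halves it, the flipped term being supported away from [dark]. *)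
Lemma cyl_at_dark s bs : cyl s bs at_dark dark = 2 ^- size bs.
Proof.
elim: bs s => [|b bs IH] s /=; first by rewrite /at_dark eqxx expr0 invr1.
rewrite /proj IH (@cyl_support _ _ _ s) ?mulr0 ?addr0.
- by rewrite exprS invfM mulrC.
- move=> a aj; rewrite /at_dark; case: eqP => // e.
  by rewrite e darkE eqxx in aj.
- by rewrite ltrDl.
- by rewrite lamp_addE lampE eqxx darkE.
Qed.

End Cylinders.

Arguments cyl_sub {R s} pre {mid} post {t f g}.

(** * The lamplighter group in the moving frame *)

Section Frames.

(** The group element seen from the walker: position [- s], lamp configuration
   translated so that left multiplication by the generator of the integers only
   moves the site [s]. *)
Definition frame (s : int) (a : lamps) : lamplighter := (lamp_shift (- s) a, - s).

Definition bulb (i : int) : lamplighter := (lamp i, 0).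

Definition walk (n : int) : lamplighter := (dark, n).

Lemma frameE (g : lamplighter) : g = frame (- g.2) (lamp_shift (- g.2) g.1).
Proof.
case: g => a n; rewrite /frame /= opprK; congr pair.
by apply/fsfunP => i; rewrite !lamp_shiftE opprK subrK.
Qed.

Lemma frame_inj s t a b : frame s a = frame t b -> s = t /\ a = b.
Proof.
move=> [e /oppr_inj st]; split=> //; rewrite st in e.
apply/fsfunP => i; have /fsfunP/(_ (i - t)) := e.
by rewrite !lamp_shiftE opprK subrK.
Qed.

Lemma frame_eq s t a b : (frame s a == frame t b) = (s == t) && (a == b).
Proof.
by apply/eqP/andP => [/frame_inj[-> ->]|[/eqP-> /eqP->]].
Qed.

Lemma frame01 : frame 0 dark = 1%g.
Proof.
rewrite -[1%g]/ll_one /frame /ll_one oppr0; congr pair.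
by apply/fsfunP => i; rewrite lamp_shiftE !fsfun0E.
Qed.

Lemma bulbV_frame i s a :
  ((bulb i)^-1 * frame s a)%g = frame s (lamp_add (lamp (s + i)) a).
Proof.
rewrite -[LHS]/(ll_mul (ll_inv (bulb i)) (frame s a)) /ll_mul /ll_inv /=.
rewrite oppr0 add0r; congr pair.
apply/fsfunP => x; rewrite !(lamp_addE, lamp_shiftE, lampE) !subr0 !opprK.
by congr (_%:R + _); rewrite (addrC s) (inj_eq (addIr s)).
Qed.

Lemma frame_bulb s a j :
  (frame s a * bulb j)%g = frame s (lamp_add (lamp j) a).
Proof.
rewrite -[LHS]/(ll_mul (frame s a) (bulb j)) /ll_mul /= addr0; congr pair.
by apply/fsfunP => x; rewrite !(lamp_addE, lamp_shiftE, lampE) addrC.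
Qed.

Lemma walkV_frame n s a : ((walk n)^-1 * frame s a)%g = frame (s + n) a.
Proof.
rewrite -[LHS]/(ll_mul (ll_inv (walk n)) (frame s a)) /ll_mul /ll_inv /=.
rewrite /frame; congr pair; last by rewrite opprD addrC.
apply/fsfunP => x; rewrite !(lamp_addE, lamp_shiftE) darkE add0r.
by rewrite !opprK (addrC s) addrA.
Qed.

Lemma bulbV j : ((bulb j)^-1)%g = bulb j.
Proof.
apply: (@mulgI _ (bulb j)); rewrite mulgV.
have {1}-> : bulb j = frame 0 (lamp j).
  rewrite /frame oppr0; congr pair.
  by apply/fsfunP => x; rewrite lamp_shiftE subr0.
rewrite frame_bulb -frame01; congr frame; apply/fsfunP => x.
by rewrite lamp_addE Z2_addxx darkE.
Qed.

End Frames.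

Section ListAction.
Variables (R : realType).

(** Formal sums of group elements represent the elements of the group algebra; they
   can be built from products of bulbs without computing convolutions. *)
Definition list_act (G : groupType) (l : seq (rat * G)) (u : G -> R) (g : G) : R :=
  \sum_(x <- l) ratr x.1 * u (x.2^-1 * g)%g.

Definition ga_of_list (G : groupType) (l : seq (rat * G)) : group_algebra G :=
  [fsfun h in [fset x.2 | x in l]%fset => \sum_(x <- l | x.2 == h) x.1].

Lemma ga_of_listE (G : groupType) (l : seq (rat * G)) (u : G -> R) :
  ga_act_real (ga_of_list l) u = list_act l u.
Proof.
apply/funext => g; rewrite /ga_act_real /list_act.
pose X := [fset x.2 | x in l]%fset.
rewrite (@big_fset_incl _ _ _ _ _ X).
- transitivity (\sum_(h <- X) \sum_(x <- l | x.2 == h) ratr x.1 * u (x.2^-1 * g)%g : R).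
    rewrite !big_seq; apply: eq_bigr => h hX.
    rewrite fsfunE hX rmorph_sum mulr_suml; apply: eq_bigr => x /eqP xh.
    by rewrite xh.
  rewrite (exchange_big_dep predT)//= big_seq [RHS]big_seq; apply: eq_bigr => x xl.
  have xX : x.2 \in X by apply/imfsetP; exists x.
  rewrite -big_filter (@eq_filter _ _ (pred1 x.2)) => [|h]; last exact: eq_sym.
  by rewrite filter_pred1_uniq ?fset_uniq// big_seq1.
- by apply/fsubsetP => h; rewrite mem_finsupp fsfunE; case: ifP => // _; rewrite eqxx.
- by move=> h _ /fsfun_dflt ->; rewrite rmorph0 mul0r.
Qed.

Definition list_proj (i : int) (b : bool) (l : seq (rat * lamplighter)) :=
  [seq (x.1 / 2, x.2) | x <- l] ++
  [seq ((-1) ^+ b * x.1 / 2, (bulb i * x.2)%g) | x <- l].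

Fixpoint list_cyl (i : int) (bs : seq bool) (l : seq (rat * lamplighter)) :=
  if bs is b :: bs' then list_proj i b (list_cyl (i + 1) bs' l) else l.

Lemma list_act_proj i b l (u : lamplighter -> R) s :
  (fun a => list_act (list_proj i b l) u (frame s a)) =
  proj (s + i) b (fun a => list_act l u (frame s a)).
Proof.
apply/funext => a; rewrite /proj /list_act big_cat !big_map /= mulrDl mulr_suml.
congr (_ + _); first by apply: eq_bigr => x _; rewrite rmorphM fmorphV rmorph_nat; ring.
rewrite mulr_sumr mulr_suml; apply: eq_bigr => x _.
rewrite !rmorphM fmorphV rmorph_nat rmorphXn rmorphN1 invgM -mulgA bulbV_frame.
by ring.
Qed.

Lemma list_act_cyl i bs l (u : lamplighter -> R) s :
  (fun a => list_act (list_cyl i bs l) u (frame s a)) =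
  cyl (s + i) bs (fun a => list_act l u (frame s a)).
Proof. by elim: bs i => //= b bs IH i; rewrite list_act_proj IH addrA. Qed.

End ListAction.

Section RightCylinders.
Variables (R : realType) (k : nat).
Local Notation V := ('I_k -> lamplighter -> R).
Implicit Types (v w : V) (bs : seq bool).

(** Cylinder projections act on the Hilbert space by right multiplication, so
   they commute with the operators given by matrices over the group algebra. *)
Definition rproj (j : int) (b : bool) v : V :=
  fun i g => (v i g + (-1) ^+ b * v i (g * bulb j)%g) / 2.

Fixpoint rcyl (s : int) bs v : V :=
  if bs is b :: bs' then rproj s b (rcyl (s + 1) bs' v) else v.

Lemma rcylE s bs v i t a :
  rcyl s bs v i (frame t a) = cyl s bs (fun a => v i (frame t a)) a.
Proof.
by elim: bs s a => //= b bs IH s a; rewrite /rproj frame_bulb !IH.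
Qed.

Lemma mulg_bulb_bij j : set_bij setT setT (fun g => (g * bulb j)%g).
Proof.
split=> [//|x y _ _ /mulIg//|y _]; exists (y * (bulb j)^-1)%g => //.
by rewrite -mulgA mulVg mulg1.
Qed.

Lemma L2_rproj j b v : L2 v -> L2 (rproj j b v).
Proof.
move=> hv i; have hs : l2 (fun g => v i (g * bulb j)%g).
  exact: (l2_reindex (mulg_bulb_bij j) (hv i)).
have := l2D (l2Z 2^-1 (hv i)) (l2Z ((-1) ^+ b / 2) hs).
by congr l2; apply/funext => g; rewrite /rproj; ring.
Qed.

Lemma L2_rcyl s bs v : L2 v -> L2 (rcyl s bs v).
Proof. by move=> hv; elim: bs s => //= b bs IH s; exact: L2_rproj. Qed.

(** Right multiplication by an involution is unitary and self-adjoint. *)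
Lemma dot_rproj j b v w : L2 v -> L2 w -> dot (rproj j b v) w = dot v (rproj j b w).
Proof.
move=> hv hw; apply: eq_bigr => i _.
have hs u : L2 u -> l2 (fun g => u i (g * bulb j)%g).
  by move=> hu; exact: (l2_reindex (mulg_bulb_bij j) (hu i)).
have E x y : l2 x -> l2 y -> l2 (fun g => y (g * bulb j)%g) ->
    rsum (fun g => x g * ((y g + (-1) ^+ b * y (g * bulb j)%g) / 2)) =
    2^-1 * rsum (fun g => x g * y g)
    + (-1) ^+ b / 2 * rsum (fun g => x g * y (g * bulb j)%g) :> R.
  move=> hx hy hy'; rewrite -!rsumZ ?l2_mul// -rsumD.
  - by congr rsum; apply/funext => g; ring.
  - by apply: abs_summableZ; exact: l2_mul.
  - by apply: abs_summableZ; exact: l2_mul.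
rewrite /rproj; under eq_fun do rewrite mulrC.
rewrite !E//; try by exact: hs.
congr (_ + _ * _); first by congr (_ * rsum _); apply/funext => g; rewrite mulrC.
rewrite -[LHS](rsum_reindex _ (mulg_bulb_bij j)).
congr rsum; apply/funext => g /=; rewrite mulrC -mulgA.
by rewrite -{2}(bulbV j) mulgV mulg1.
Qed.

Lemma dot_rcyl s bs v w : L2 v -> L2 w -> dot (rcyl s bs v) w = dot v (rcyl s bs w).
Proof.
move=> hv hw; elim: bs s v hv => //= b bs IH s v hv.
have rcyl_proj t u : rcyl t bs (rproj s b u) = rproj s b (rcyl t bs u).
  apply/funext => i; apply/funext => g; rewrite (frameE g).
  rewrite rcylE /rproj frame_bulb.
  under eq_fun do rewrite frame_bulb.
  rewrite -[X in cyl t bs X]/(proj s b (fun a => u i (frame _ a))) cyl_projC.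
  by rewrite /proj !rcylE.
by rewrite -rcyl_proj IH ?dot_rproj//; [exact: L2_rcyl|exact: L2_rproj].
Qed.

End RightCylinders.

(** * Words as blocks of lamps, and the linear system that reads them *)

Section Words.

Definition step (x : 'I_2) : int := (-1) ^+ x.

Definition balance (w : word) : int := \sum_(x <- w) step x.

Definition encl (x : 'I_2) : seq bool := rcons (nseq x.+1 false) true.

Definition enc (w : word) : seq bool := flatten (map encl w).

Lemma ord2P (x : 'I_2) : x = ord0 \/ x = ord_max.
Proof. by case: x => [[|[|//]] h]; [left|right]; apply: val_inj. Qed.

Lemma weight_cons x w : weight (x :: w) = (x.+2 + weight w)%N.
Proof. by rewrite /weight big_cons. Qed.

Lemma weight_cat u v : weight (u ++ v) = (weight u + weight v)%N.
Proof. by rewrite /weight big_cat. Qed.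

Lemma balance_cons x w : balance (x :: w) = step x + balance w.
Proof. by rewrite /balance big_cons. Qed.

Lemma balance_nil : balance [::] = 0. Proof. by rewrite /balance big_nil. Qed.

Lemma enc_cons x w : enc (x :: w) = encl x ++ enc w. Proof. by []. Qed.

Lemma enc_cat u v : enc (u ++ v) = enc u ++ enc v.
Proof. by rewrite /enc map_cat flatten_cat. Qed.

Lemma size_encl x : size (encl x) = x.+2.
Proof. by rewrite size_rcons size_nseq. Qed.

Lemma size_enc w : size (enc w) = weight w.
Proof.
elim: w => [|x w IH]; first by rewrite /weight big_nil.
by rewrite enc_cons size_cat size_encl IH weight_cons.
Qed.

Definition block (w : word) : seq bool := true :: true :: enc w ++ [:: true].

Lemma size_block w : size (block w) = (weight w + 3)%N.
Proof. by rewrite /block /= size_cat size_enc /=; lia. Qed.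

(** A word that has just been read ends on a 1, at distance [weight w]. *)
Lemma enc_last w : exists2 pre, true :: enc w = rcons pre true & size pre = weight w.
Proof.
elim/last_ind: w => [|w x _].
  by exists [::] => //; rewrite /weight big_nil.
exists (true :: enc w ++ nseq x.+1 false).
  by rewrite -cats1 enc_cat enc_cons /= cats0 rcons_cat.
rewrite /= size_cat /= size_nseq size_enc -cats1 weight_cat weight_cons.
by rewrite {3}/weight big_nil addn0 !addnS.
Qed.

End Words.

Section System.

(** An equation [(bs, l)] of the system requires, at every site [s], that the
   combination [l] of unknowns around [s] vanishes on the cylinder of the
   configurations that read [bs] from [s] on. There are two unknowns at each
   site, indexed by booleans. *)
Definition linform := seq (rat * (nat * bool)).

Definition lin_term (c : rat) (k : nat) (b : bool) : rat * (nat * bool) :=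
  (c, (k, b)).

(** Going from one 1 to the next one keeps the unknown [false] and adds its multiple
   by the step of the letter to the unknown [true], which thus counts letters. *)
Definition letter_eqs (x : 'I_2) : seq (seq bool * linform) :=
  [:: (true :: encl x, [:: lin_term 1 x.+2 false; lin_term (-1) 0 false]);
      (true :: encl x, [:: lin_term 1 x.+2 true; lin_term (-1) 0 true;
                           lin_term (- (step x)%:~R) 0 false])].

(** Both unknowns vanish at a 0. The pattern 11 is both the end of a block, at its
   first site, and the beginning of another one, at its second site; the counter
   vanishes at either. The patterns 1000 and 0001 bound no block, so everything
   vanishes there. *)
Definition system : seq (seq bool * linform) :=
  letter_eqs ord0 ++ letter_eqs ord_max ++
  [:: ([:: false], [:: lin_term 1 0 false]);
      ([:: false], [:: lin_term 1 0 true]);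
      ([:: true; true], [:: lin_term 1 0 true]);
      ([:: true; true], [:: lin_term 1 1 true]);
      ([:: true; false; false; false], [:: lin_term 1 0 false]);
      ([:: true; false; false; false], [:: lin_term 1 0 true]);
      ([:: false; false; false; true], [:: lin_term 1 3 false]);
      ([:: false; false; false; true], [:: lin_term 1 3 true])].

Variable R : realType.
Implicit Types W : bool -> int -> lamps -> R.

Definition eval_linform (l : linform) W s : lamps -> R :=
  fun a => \sum_(x <- l) ratr x.1 * W x.2.2 (s + x.2.1%:Z) a.

Definition solves W := forall e, e \in system ->
  forall s, cyl s e.1 (eval_linform e.2 W s) = fun=> 0.

Section Solution.
Variables (W : bool -> int -> lamps -> R) (solW : solves W).

Let single bs (k : nat) b s : (bs, [:: lin_term 1 k b]) \in system ->
  cyl s bs (W b (s + k%:Z)) = cyl s bs (fun=> 0).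
Proof.
move=> /solW/(_ s)/= h; rewrite cyl0 -[RHS]h; congr cyl.
by apply/funext => a; rewrite /eval_linform big_seq1 rmorph1 mul1r.
Qed.

Lemma solves_off s b : cyl s [:: false] (W b s) = cyl s [:: false] (fun=> 0).
Proof.
have := @single [:: false] 0%N b s; rewrite addr0; apply.
by case: b; rewrite !inE eqxx ?orbT.
Qed.

Lemma solves_stop s :
  cyl s [:: true; true] (W true s) = cyl s [:: true; true] (fun=> 0).
Proof.
have := @single [:: true; true] 0%N true s; rewrite addr0; apply.
by rewrite !inE eqxx ?orbT.
Qed.

Lemma solves_start s :
  cyl s [:: true; true] (W true (s + 1)) = cyl s [:: true; true] (fun=> 0).
Proof.
by have := @single [:: true; true] 1%N true s; apply; rewrite !inE eqxx ?orbT.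
Qed.

Lemma solves_dead_stop s b : cyl s [:: true; false; false; false] (W b s)
  = cyl s [:: true; false; false; false] (fun=> 0).
Proof.
have := @single [:: true; false; false; false] 0%N b s; rewrite addr0; apply.
by case: b; rewrite !inE eqxx ?orbT.
Qed.

Lemma solves_dead_start s b : cyl s [:: false; false; false; true] (W b (s + 3))
  = cyl s [:: false; false; false; true] (fun=> 0).
Proof.
have := @single [:: false; false; false; true] 3%N b s; apply.
by case: b; rewrite !inE eqxx ?orbT.
Qed.

Lemma letter_eqs_system x e : e \in letter_eqs x -> e \in system.
Proof.
by case: (ord2P x) => -> h; rewrite /system !mem_cat h ?orbT.
Qed.

Lemma solves_letter s x :
  cyl s (true :: encl x) (W false (s + x.+2%:Z)) =
    cyl s (true :: encl x) (W false s) /\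
  cyl s (true :: encl x) (W true (s + x.+2%:Z)) =
    cyl s (true :: encl x) (fun a => W true s a + (step x)%:~R * W false s a).
Proof.
have cyl_eq bs (f g : lamps -> R) : cyl s bs (fun a => f a - g a) = (fun=> 0) ->
    cyl s bs f = cyl s bs g.
  rewrite cylB => h; apply/funext => a; apply/eqP; rewrite -subr_eq0.
  by have := congr1 (fun F => F a) h => /= ->.
split; apply: cyl_eq.
  have /letter_eqs_system/solW/(_ s) <- :
      nth ([::], [::]) (letter_eqs x) 0 \in letter_eqs x by rewrite mem_nth.
  congr cyl; apply/funext => a.
  by rewrite /eval_linform !big_cons big_nil /= !addr0 rmorphN1 rmorph1; ring.
have /letter_eqs_system/solW/(_ s) <- :
    nth ([::], [::]) (letter_eqs x) 1 \in letter_eqs x by rewrite mem_nth.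
congr cyl; apply/funext => a.
rewrite /eval_linform !big_cons big_nil /= !addr0 rmorphN1 rmorph1 rmorphN.
by rewrite rmorph_int; ring.
Qed.

(** By induction on the word, each letter being read on the part of the cylinder
   that prescribes it. *)
Lemma solves_word s w :
  cyl s (true :: enc w) (W false (s + (weight w)%:Z)) =
    cyl s (true :: enc w) (W false s) /\
  cyl s (true :: enc w) (W true (s + (weight w)%:Z)) =
    cyl s (true :: enc w) (fun a => W true s a + (balance w)%:~R * W false s a).
Proof.
elim: w s => [|x w IH] s.
  rewrite /weight big_nil addr0 balance_nil; split=> //; congr cyl.
  by apply/funext => a; rewrite mul0r addr0.
have [hU hC] := solves_letter s x.
have [] := IH (s + x.+2%:Z); rewrite -!addrA -!PoszD -weight_cons => IU IC.
have encE : true :: enc (x :: w) = (true :: nseq x.+1 false) ++ (true :: enc w) ++ [::].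
  by rewrite enc_cons /encl cats0 cat_rcons.
have encE' : true :: enc (x :: w) = [::] ++ (true :: encl x) ++ enc w by [].
have t1 : s + x.+2%:Z = s + (size (true :: nseq x.+1 false))%:Z.
  by rewrite /= size_nseq.
have t2 : s = s + (size ([::] : seq bool))%:Z by rewrite addr0.
have {}hU := cyl_sub [::] (enc w) t2 hU; have {}hC := cyl_sub [::] (enc w) t2 hC.
have {}IU := cyl_sub (true :: nseq x.+1 false) [::] t1 IU.
have {}IC := cyl_sub (true :: nseq x.+1 false) [::] t1 IC.
rewrite -!encE' in hU hC; rewrite -!encE in IU IC.
split; first by rewrite IU hU.
rewrite IC !cylD hC; apply/funext => a; rewrite cylD !cylZ hU balance_cons.
by rewrite intrD mulrDl addrA.
Qed.

(** Both unknowns vanish at the last 1 before three zeros, and [solves_word] is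
   invertible, so they vanish at all the letters before it. *)
Lemma solves_dead_right s w b :
  cyl s (true :: enc w ++ [:: false; false; false]) (W b s) = fun=> 0.
Proof.
have [hU hC] := solves_word s w.
have t2 : s = s + (size ([::] : seq bool))%:Z by rewrite addr0.
have {}hU := cyl_sub [::] [:: false; false; false] t2 hU.
have {}hC := cyl_sub [::] [:: false; false; false] t2 hC.
rewrite cat0s cat_cons in hU hC.
have [pre preE szpre] := enc_last w.
have t3 : s + (weight w)%:Z = s + (size pre)%:Z by rewrite szpre.
have dead b' : cyl s (true :: enc w ++ [:: false; false; false])
    (W b' (s + (weight w)%:Z)) = fun=> 0.
  have := cyl_sub pre [::] t3 (solves_dead_stop (s + (weight w)%:Z) b').
  by rewrite cats0 -cat_cons preE cat_rcons cyl0.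
have U0 : cyl s (true :: enc w ++ [:: false; false; false]) (W false s) = fun=> 0.
  by rewrite -hU dead.
case: b => //; rewrite dead cylD cylZ U0 in hC.
apply/funext => a; have := congr1 (fun F => F a) hC => /= ->.
by rewrite mulr0 addr0.
Qed.

(** The mirror image of [solves_dead_right], with the vanishing propagating
   forward from three zeros. *)
Lemma solves_dead_left s w bs b :
  cyl (s - 3 - (weight w)%:Z) ([:: false; false; false; true] ++ enc w ++ bs) (W b s)
  = fun=> 0.
Proof.
set p := s - 3 - _.
have [] := solves_word (p + 3) w.
have -> : p + 3 + (weight w)%:Z = s by rewrite /p; ring.
move=> hU hC.
have t1 : p + 3 = p + (size [:: false; false; false])%:Z by [].
have t2 : p = p + (size ([::] : seq bool))%:Z by rewrite addr0.
have {}hU := cyl_sub [:: false; false; false] bs t1 hU.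
have {}hC := cyl_sub [:: false; false; false] bs t1 hC.
have E : [:: false; false; false] ++ (true :: enc w) ++ bs =
    [:: false; false; false; true] ++ enc w ++ bs by [].
rewrite E in hU hC.
have dead b' : cyl p ([:: false; false; false; true] ++ enc w ++ bs) (W b' (p + 3))
    = fun=> 0.
  have := cyl_sub [::] (enc w ++ bs) t2 (solves_dead_start p b').
  by rewrite cat0s cyl0.
case: b; last by rewrite hU dead.
by rewrite hC cylD cylZ !dead; apply/funext => a; rewrite mulr0 addr0.
Qed.


(** The marker on the left starts the counter at 0, so that it equals the balance
   of the prefix times [U0]; the marker on the right requires this to be 0 for the
   whole word. *)
Lemma solves_block p u v :
  let U0 := cyl p (block (u ++ v)) (W false (p + 1)) in
  [/\ cyl p (block (u ++ v)) (W false (p + 1 + (weight u)%:Z)) = U0,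
      cyl p (block (u ++ v)) (W true (p + 1 + (weight u)%:Z)) =
        (fun a => (balance u)%:~R * U0 a) &
      forall a, (balance (u ++ v))%:~R * U0 a = 0].
Proof.
move=> U0.
have t1 : p + 1 = p + (size [:: true])%:Z by [].
have t2 : p = p + (size ([::] : seq bool))%:Z by rewrite addr0.
have C0 : cyl p (block (u ++ v)) (W true (p + 1)) = fun=> 0.
  by have := cyl_sub [::] (enc (u ++ v) ++ [:: true]) t2 (solves_start p); rewrite cyl0.
have reach u' v' : cyl p (block (u' ++ v')) (W true (p + 1)) = (fun=> 0) ->
    cyl p (block (u' ++ v')) (W false (p + 1 + (weight u')%:Z)) =
      cyl p (block (u' ++ v')) (W false (p + 1)) /\
    cyl p (block (u' ++ v')) (W true (p + 1 + (weight u')%:Z)) =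
      fun a => (balance u')%:~R * cyl p (block (u' ++ v')) (W false (p + 1)) a.
  move=> C0'; have [hU hC] := solves_word (p + 1) u'.
  have {}hU := cyl_sub [:: true] (enc v' ++ [:: true]) t1 hU.
  have {}hC := cyl_sub [:: true] (enc v' ++ [:: true]) t1 hC.
  have bE : block (u' ++ v') = [:: true] ++ (true :: enc u') ++ enc v' ++ [:: true].
    by rewrite /block enc_cat -!catA.
  rewrite -bE in hU hC; split=> //; rewrite hC cylD cylZ C0'.
  by apply/funext => a; rewrite add0r.
have [h1 h2] := reach u v C0; split=> // a.
have := reach (u ++ v) [::]; rewrite cats0 => /(_ C0)[_ hfull].
have := congr1 (fun F : lamps -> R => F a) hfull; cbv beta => <-.
have [pre preE szpre] := enc_last (u ++ v).
have -> : block (u ++ v) = (true :: pre) ++ [:: true; true] ++ [::].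
  by rewrite /block -(cat_cons true) preE -cats1 -catA.
have t3 : p + 1 + (weight (u ++ v))%:Z = p + (size (true :: pre))%:Z.
  by rewrite /= szpre -addrA -PoszD.
by rewrite (cyl_sub (true :: pre) [::] t3 (solves_stop _)) cyl0.
Qed.

End Solution.

End System.

(** * The solution carried by a balanced block *)

Section Profile.

(** What a balanced block prescribes at a site: the bit, if the site belongs to
   the block, and the values of the two unknowns. *)
Definition symbol : eqType := (option bool * (rat * rat))%type.

Definition value (b : bool) (y : symbol) : rat := if b then y.2.2 else y.2.1.

Definition blank : symbol := (None, (0, 0)).

Fixpoint profile_tail (c : rat) (w : word) : seq symbol :=
  if w is x :: w' then
    nseq x.+1 (Some false, (0, 0)) ++
    (Some true, (1, c + (step x)%:~R)) :: profile_tail (c + (step x)%:~R) w'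
  else [:: (Some true, (0, 0))].

Definition profile_from c w : seq symbol := (Some true, (1, c)) :: profile_tail c w.

(** The three blanks let patterns that start before the block overlap it. *)
Definition profile w : seq symbol :=
  [:: blank, blank, blank, (Some true, (0, 0)) & profile_from 0 w].

(** A pattern fits a list of symbols unless a prescribed bit contradicts it; only
   equations whose pattern fits have to be checked on the values. *)
Fixpoint fits (bs : seq bool) (l : seq symbol) : bool :=
  if bs is b :: bs' then
    (((head blank l).1 == None) || ((head blank l).1 == Some b)) && fits bs' (behead l)
  else true.

Definition satisfied (l : seq symbol) : bool :=
  all (fun e => fits e.1 l ==>
    (\sum_(x <- e.2) x.1 * value x.2.2 (nth blank l x.2.1) == 0)) system.

Fixpoint all_satisfied (l : seq symbol) : bool :=
  satisfied l && (if l is _ :: l' then all_satisfied l' else true).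

Lemma all_satisfied_cons y l :
  all_satisfied (y :: l) = satisfied (y :: l) && all_satisfied l.
Proof. by []. Qed.

Lemma all_satisfied_drop l m : all_satisfied l -> satisfied (drop m l).
Proof.
elim: l m => [|y l IH] [|m] //=; rewrite ?andbT//.
- by move=> /andP[].
- by move=> /andP[_ /IH].
Qed.

Ltac check_system :=
  rewrite /satisfied /=;
  repeat (match goal with |- is_true (_ && _) => apply/andP; split end) => //;
  rewrite ?implybT ?implyTb ?andbF // ?implyTb ?big_cons ?big_nil /value /=;
  rewrite ?mulr0 ?addr0 ?eqxx//.

(** The equations reach three sites ahead, and the bits of one letter already
   decide which patterns fit; so each letter can be checked on its own. *)
Lemma profile_from_satisfied c w : c + (balance w)%:~R = 0 ->
  all_satisfied (profile_from c w).
Proof.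
elim: w c => [|x w IH] c.
  rewrite balance_nil addr0 => -> /=.
  by check_system; check_system.
rewrite balance_cons intrD addrA => /IH {}IH.
have -> : profile_from c (x :: w) =
  [:: (Some true, (1, c)), (Some false, (0, 0)) & nseq x (Some false, (0, 0)) ++
    profile_from (c + (step x)%:~R) w] by [].
case: (ord2P x) IH => -> IH.
  rewrite 2!all_satisfied_cons IH andbT; apply/andP; split; check_system;
  rewrite /step expr0; apply/eqP; ring.
rewrite 3!all_satisfied_cons IH andbT; apply/andP; split; [|apply/andP; split];
  check_system; rewrite /step expr1; apply/eqP; ring.
Qed.

Lemma profile_satisfied w : balance w = 0 -> all_satisfied (profile w).
Proof.
move=> bal0; rewrite /profile 4!all_satisfied_cons.
rewrite profile_from_satisfied ?bal0 ?addr0//.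
rewrite /profile_from.
by rewrite andbT; do 3!(apply/andP; split); check_system.
Qed.

End Profile.

Section BlockSolution.
Variable R : realType.

(** The values of the unknowns at the end of the prefix [u]. *)
Definition amplitude (b : bool) (u : word) : R := if b then (balance u)%:~R else 1.

Definition site_value (w : word) (p : int) (b : bool) (s : int) : R :=
  \sum_(j < (size w).+1)
    (s == p + 1 + (weight (take j w))%:Z)%:R * amplitude b (take j w).

Definition block_solution w p (b : bool) (s : int) : lamps -> R :=
  fun a => site_value w p b s * cyl p (block w) (at_dark R) a.

Lemma value_profile_from b c w m :
  value b (nth blank (profile_from c w) m) =
  \sum_(j < (size w).+1) (m == weight (take j w))%:R *
    (if b then c + (balance (take j w))%:~R else 1).
Proof.
elim: w c m => [|x w IH] c m.
  rewrite big_ord1 take0 /weight balance_nil big_nil addr0.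
  by case: m => [|[|m]]; case: b; rewrite ?mul1r ?mul0r//= nth_nil.
rewrite big_ord_recl take0 {1}/weight big_nil balance_nil addr0.
under eq_bigr => j _ do rewrite lift0 /= weight_cons balance_cons.
case: m => [|m].
  by rewrite big1 => [|j _]; rewrite ?mul0r// mul1r addr0; case: (b).
rewrite mul0r add0r -[profile_from c _]/((Some true, (1, c)) ::
  nseq x.+1 (Some false, (0, 0)) ++ profile_from (c + (step x)%:~R) w).
have nthS y l : nth blank (y :: l) m.+1 = nth blank l m by [].
rewrite nthS nth_cat size_nseq; have [mx|xm] := ltnP m x.+1.
  rewrite nth_nseq mx big1 => [|j _]; first by rewrite /value; case: (b).
  by rewrite [_ == _]negbTE ?mul0r//; lia.
rewrite IH; apply: eq_bigr => j _; rewrite intrD addrA; congr (_%:R * _).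
by congr nat_of_bool; apply/eqP/eqP; lia.
Qed.

Lemma map_fst_profile w :
  [seq y.1 | y <- profile w] = nseq 3 None ++ [seq Some b | b <- block w].
Proof.
suff tailE c : [seq y.1 | y <- profile_tail c w] =
    [seq Some b | b <- enc w ++ [:: true]].
  by rewrite /profile /profile_from /block !map_cons tailE.
elim: w c => // x w IH c.
rewrite -[profile_tail _ _]/(nseq x.+1 (Some false, (0, 0)) ++
  (Some true, (1, c + (step x)%:~R)) :: profile_tail (c + (step x)%:~R) w).
rewrite [LHS]map_cat map_nseq map_cons IH enc_cons /encl cat_rcons -catA.
by rewrite [RHS]map_cat map_nseq.
Qed.

Lemma profile_bit w m b : (nth blank (profile w) m).1 = Some b ->
  [/\ (3 <= m)%N, (m - 3 < size (block w))%N & nth false (block w) (m - 3) = b].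
Proof.
have nth_fst l : (nth blank l m).1 = nth None [seq y.1 | y <- l] m.
  have [h|h] := ltnP m (size l); first by rewrite (nth_map blank).
  by rewrite !nth_default// size_map.
rewrite nth_fst map_fst_profile nth_cat size_nseq.
case: ltnP => hm; first by rewrite nth_nseq hm.
have [h|h] := ltnP (m - 3) (size (block w)); last by rewrite nth_default// size_map.
by rewrite (nth_map false)// => -[].
Qed.

Lemma fitsPn bs l : ~~ fits bs l -> exists i b,
  [/\ (i < size bs)%N, (nth blank l i).1 = Some b & nth false bs i != b].
Proof.
elim: bs l => //= b bs IH l; rewrite negb_and => /orP[|/IH].
  case e : (head blank l).1 => [b'|]//= hb; exists 0%N, b'; split => //.
  by apply: contra hb => /eqP /= ->.
move=> [i [b' [ib hi ne]]]; exists i.+1, b'; split => //.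
by rewrite -hi -nth_behead.
Qed.

Lemma site_value_profile w p b m :
  site_value w p b (p - 3 + m%:Z) = ratr (value b (nth blank (profile w) m)).
Proof.
have [m4|m4] := ltnP m 4.
  rewrite /site_value big1 => [|j _]; last first.
    by rewrite [_ == _]negbTE ?mul0r//; apply/eqP; lia.
  by case: m m4 => [|[|[|[|]]]]//= _; case: b; rewrite rmorph0.
have -> : m = (m - 4).+4 by lia.
move: (m - 4)%N => n; rewrite /= value_profile_from rmorph_sum.
apply: eq_bigr => j _; rewrite rmorphM rmorph_nat; congr (_%:R * _).
  by congr nat_of_bool; apply/eqP/eqP; lia.
by case: b; rewrite /amplitude ?rmorph1// add0r rmorph_int.
Qed.

Lemma site_value_before w p b s : s < p -> site_value w p b s = 0.
Proof.
move=> sp; apply: big1 => j _; rewrite [_ == _]negbTE ?mul0r//; apply/eqP; lia.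
Qed.

Lemma system_range : all (fun e => all (fun x => x.2.1 <= 3)%N e.2) system.
Proof. by []. Qed.

(** At every site, either the pattern of the equation contradicts a bit of the
   block, and the two cylinders are disjoint, or the equation holds for the values
   of the profile. *)
Lemma block_solution_solves w p : balance w = 0 -> solves (block_solution w p).
Proof.
move=> bal0 e esys s.
have evalE : eval_linform e.2 (block_solution w p) s = fun a =>
    (\sum_(x <- e.2) ratr x.1 * site_value w p x.2.2 (s + x.2.1%:Z)) *
    cyl p (block w) (at_dark R) a.
  apply/funext => a; rewrite /eval_linform mulr_suml; apply: eq_bigr => x _.
  by rewrite /block_solution mulrA.
rewrite evalE cylZ.
have [sp|ps] := ltP s (p - 3).
  rewrite big_seq big1 => [|x xe]; first by apply/funext => a; rewrite mul0r.
  rewrite site_value_before ?mulr0//.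
  have /allP/(_ _ esys)/allP/(_ _ xe) := system_range.
  by move: x.2.1 sp => /= k; lia.
have [m -> {ps}] : exists m : nat, s = p - 3 + m%:Z.
  by exists (absz (s - (p - 3))%R); lia.
have [hfit|/fitsPn[i [b [ibs hi ne]]]] := boolP (fits e.1 (drop m (profile w))).
  have /allP/(_ _ esys) := all_satisfied_drop m (profile_satisfied bal0).
  rewrite hfit => /eqP h0.
  under eq_bigr => x _ do rewrite -addrA -PoszD site_value_profile -nth_drop -rmorphM.
  by rewrite -rmorph_sum h0 rmorph0; apply/funext => a; rewrite mul0r.
rewrite nth_drop in hi; have [h1 h2 h3] := profile_bit hi.
rewrite (@cyl_conflict _ _ _ _ _ _ i (m + i - 3)%N)//.
- by apply/funext => a; rewrite mulr0.
- lia.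
- by rewrite h3.
Qed.

End BlockSolution.

(** * The matrix of the system and the diagonal values of its projection *)

Section Matrix.
Variable R : realType.
Local Notation V := ('I_12 -> lamplighter -> R).
Implicit Types (v q z : V) (w u : word).

Definition unknown (b : bool) : 'I_12 := inord b.

Lemma unknown_inj : injective unknown.
Proof.
by move=> b c /(congr1 val); rewrite /= !inordK; case: b; case: c.
Qed.

(** One row for each equation. The matrix has to be square, so the columns of the
   two unknowns are completed by zero columns, each of which adds 1 to the Betti
   number. *)
Definition system_mx : 'M[group_algebra lamplighter]_12 :=
  \matrix_(i, j) let e := nth ([::], [::]) system i in
    ga_of_list (list_cyl 0 e.1
      [seq (x.1, walk x.2.1%:Z) | x <- e.2 & unknown x.2.2 == j]).

Definition unknowns v (b : bool) (s : int) : lamps -> R :=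
  fun a => v (unknown b) (frame s a).

Lemma system_mx_act v (i : 'I_12) s a :
  let e := nth ([::], [::]) system i in
  \sum_(j < 12) ga_act_real (system_mx i j) (v j) (frame s a) =
  cyl s e.1 (eval_linform e.2 (unknowns v) s) a.
Proof.
move=> e; rewrite /eval_linform.
transitivity (\sum_(j < 12) cyl s e.1 (fun a' => \sum_(x <- e.2 | unknown x.2.2 == j)
    ratr x.1 * unknowns v x.2.2 (s + x.2.1%:Z) a') a).
  apply: eq_bigr => j _; rewrite mxE -/e ga_of_listE.
  have := congr1 (fun F => F a) (list_act_cyl 0 e.1 [seq (x.1, walk x.2.1%:Z)
    | x <- e.2 & unknown x.2.2 == j] (v j) s).
  cbv beta => ->; rewrite addr0; congr (cyl _ _ _ _); apply/funext => a'.
  rewrite /list_act big_map big_filter; apply: eq_bigr => x /eqP <-.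
  by rewrite walkV_frame.
rewrite -(congr1 (fun F => F a) (cyl_sum (index_enum 'I_12) s e.1 _)).
congr (cyl _ _ _ _); apply/funext => a'.
rewrite (exchange_big_dep predT)//=; apply: eq_bigr => x _.
by rewrite (big_pred1 (unknown x.2.2))// => j; exact: eq_sym.
Qed.

Lemma real_ker_system v :
  real_ker system_mx v <-> L2 v /\ solves (unknowns v).
Proof.
split=> [[Lv h]|[Lv h]]; split=> //.
  move=> e esys s; apply/funext => a.
  have ie : (index e system < 12)%N by rewrite -[12%N]/(size system) index_mem.
  have := system_mx_act v (Ordinal ie) s a; rewrite h /= nth_index//.
by move=> i g; rewrite (frameE g) system_mx_act h// mem_nth.
Qed.

Lemma L2_sum (I : Type) (r : seq I) (c : I -> R) (F : I -> V) :
  (forall x, L2 (F x)) -> L2 (fun i g => \sum_(x <- r) c x * F x i g).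
Proof.
move=> hF; elim: r => [|x r IH].
  move=> i; under eq_fun do rewrite big_nil.
  by rewrite /l2 esum1 ?ltry// => g _; rewrite expr0n.
have := L2_lincomb (c x) 1 (hF x) IH; congr L2.
apply/funext => i; apply/funext => g.
by rewrite /lincomb big_cons mul1r.
Qed.

Lemma dot_sum v (I : Type) (r : seq I) (c : I -> R) (F : I -> V) : L2 v ->
  (forall x, L2 (F x)) ->
  dot v (fun i g => \sum_(x <- r) c x * F x i g) = \sum_(x <- r) c x * dot v (F x).
Proof.
move=> hv hF; elim: r => [|x r IH].
  rewrite big_nil /dot big1// => i _.
  by under eq_fun do rewrite big_nil mulr0; exact: rsum0.
have e : (fun i g => \sum_(y <- x :: r) c y * F y i g) =
    lincomb (c x) 1 (F x) (fun i g => \sum_(y <- r) c y * F y i g).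
  by apply/funext => i; apply/funext => g; rewrite /lincomb big_cons mul1r.
by rewrite e dot_lincombr ?IH ?mul1r ?big_cons//; exact: L2_sum.
Qed.

Section BlockVector.
Variables (w : word) (p : int).

Let site (x : bool * 'I_(size w).+1) := p + 1 + (weight (take x.2 w))%:Z.

(** The solution of the block, before it is cut down to the cylinder. *)
Definition block_support : V := fun i g =>
  \sum_(x : bool * 'I_(size w).+1) amplitude R x.1 (take x.2 w) *
    delta_vec R (unknown x.1) (frame (site x) dark) i g.

Definition block_vector : V := rcyl p (block w) block_support.

Lemma L2_block_support : L2 block_support.
Proof. by apply: L2_sum => x; exact: L2_delta. Qed.

Lemma block_vectorE b s :
  unknowns block_vector b s = block_solution R w p b s.
Proof.
apply/funext => a; rewrite /unknowns /block_vector rcylE /block_solution.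
rewrite -[RHS](congr1 (fun F => F a) (cylZ _ _ _ _)).
congr (cyl _ _ _ _); apply/funext => a' /=.
rewrite /block_support (eq_bigr (fun x : bool * 'I_(size w).+1 =>
  (x.1 == b)%:R * ((s == site x)%:R * amplitude R x.1 (take x.2 w) * at_dark R a'))).
  rewrite -(pair_big predT predT (fun c j => (c == b)%:R * ((s == site (c, j))%:R *
    amplitude R c (take j w) * at_dark R a')))/=.
  rewrite (bigD1 b)//= [X in _ + X]big1 ?addr0 => [|c /negbTE cb].
    by rewrite /site_value mulr_suml; apply: eq_bigr => j _; rewrite eqxx mul1r.
  by rewrite big1// => j _; rewrite cb mul0r.
move=> x _; rewrite /delta_vec frame_eq (inj_eq unknown_inj) (eq_sym b) /at_dark.
by rewrite -mulnb natrM; ring.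
Qed.

Lemma block_vector_ker : balance w = 0 -> real_ker system_mx block_vector.
Proof.
move=> bal0; apply/real_ker_system; split; first exact/L2_rcyl/L2_block_support.
move=> e esys s; rewrite -[RHS](block_solution_solves R p bal0 esys s).
congr cyl; apply/funext => a; apply: eq_bigr => x _.
by rewrite block_vectorE.
Qed.

Lemma dot_block_vector q : L2 q -> dot q block_vector =
  \sum_(x : bool * 'I_(size w).+1) amplitude R x.1 (take x.2 w) *
    cyl p (block w) (unknowns q x.1 (site x)) dark.
Proof.
move=> Lq; have Lr : L2 (rcyl p (block w) q) by exact: L2_rcyl.
have Ls := L2_block_support.
rewrite /block_vector -dot_rcyl// dot_sum//; last by move=> x; exact: L2_delta.
by apply: eq_bigr => x _; rewrite dotC dot_delta rcylE.
Qed.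

End BlockVector.

(** The squared norm of the values (1, balance) of a solution along a block. *)
Definition block_norm w : R :=
  \sum_(j < (size w).+1) (1 + (balance (take j w))%:~R ^+ 2).

Lemma block_norm_gt0 w : 0 < block_norm w.
Proof.
rewrite /block_norm big_ord_recl ltr_pwDl ?sumr_ge0//.
  by rewrite ltr_pwDl ?sqr_ge0.
by move=> j _; rewrite addr_ge0 ?sqr_ge0.
Qed.

Lemma weight_take_inj w i j : (i <= size w)%N -> (j <= size w)%N ->
  weight (take i w) = weight (take j w) -> i = j.
Proof.
elim: w i j => [|x w IH] [|i] [|j] //=; rewrite ?weight_cons ?ltnS.
- by rewrite {1}/weight big_nil.
- by rewrite {2}/weight big_nil.
- by move=> hi hj /addnI /(IH _ _ hi hj) ->.
Qed.

(** On the cylinder of a block, a vector of the kernel is a multiple of the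
   solution carried by the block; pairing with that solution gives the factor. *)
Lemma block_value q b u (v : word) :
  real_ker system_mx q ->
  (forall z, real_ker system_mx z -> dot q z = z (unknown b) 1%g) ->
  cyl (- 1 - (weight u)%:Z) (block (u ++ v)) (unknowns q b 0) dark =
  if balance (u ++ v) == 0 then
    amplitude R b u ^+ 2 * 2 ^- (weight (u ++ v) + 3) / block_norm (u ++ v)
  else 0.
Proof.
move=> /[dup] Kq /real_ker_system[Lq solq] hq; set w := u ++ v; set p := _ - _.
pose U0 := cyl p (block w) (unknowns q false (p + 1)) dark.
have val c u' (v' : word) : w = u' ++ v' ->
    cyl p (block w) (unknowns q c (p + 1 + (weight u')%:Z)) dark =
    amplitude R c u' * U0.
  move=> wE; have [h1 h2 _] := solves_block solq p u' v'.
  by rewrite -wE in h1 h2; case: c; rewrite ?h1 ?h2 /amplitude ?mul1r.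
have -> : unknowns q b 0 = unknowns q b (p + 1 + (weight u)%:Z).
  by congr (unknowns q b _); rewrite /p; lia.
rewrite (val b u v)//.
have [_ _ /(_ dark) hbal] := solves_block solq p u v.
rewrite -/w -/U0 in hbal; case: eqP => [bal0|/eqP nbal]; last first.
  move/eqP: hbal; rewrite mulf_eq0 intr_eq0 (negbTE nbal) /= => /eqP ->.
  by rewrite mulr0.
have := hq _ (block_vector_ker p bal0).
rewrite -frame01 -[block_vector _ _ _ _]/(unknowns (block_vector w p) b 0 dark).
rewrite block_vectorE /block_solution cyl_at_dark size_block dot_block_vector//.
have -> : site_value R w p b 0 = amplitude R b u.
  have su : (size u < (size w).+1)%N by rewrite ltnS size_cat leq_addr.
  rewrite /site_value (bigD1 (Ordinal su))//= take_size_cat// big1 => [|j ju].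
    by rewrite [_ == _](_ : _ = true) ?mul1r ?addr0//; apply/eqP; rewrite /p; lia.
  rewrite [_ == _]negbTE ?mul0r//; apply: contra ju => /eqP hj.
  have jw : (j <= size w)%N by rewrite -ltnS.
  apply/eqP/val_inj/(weight_take_inj jw su) => /=.
  by rewrite [in RHS]take_size_cat//; move: hj; rewrite /p; lia.
rewrite -(pair_big predT predT (fun c (j : 'I_(size w).+1) => amplitude R c (take j w) *
  cyl p (block w) (unknowns q c (p + 1 + (weight (take j w))%:Z)) dark))/=.
rewrite exchange_big/=.
have -> : \sum_(j < (size w).+1) \sum_(c : bool) amplitude R c (take j w) *
    cyl p (block w) (unknowns q c (p + 1 + (weight (take j w))%:Z)) dark =
    block_norm w * U0.
  rewrite /block_norm mulr_suml; apply: eq_bigr => j _.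
  by rewrite big_bool !(val _ (take j w) (drop j w)) ?cat_take_drop// /amplitude /=; ring.
have N0 : block_norm w != 0 by rewrite gt_eqF// block_norm_gt0.
move=> h; have -> : U0 = amplitude R b u * 2 ^- (weight w + 3) / block_norm w.
  by rewrite -h mulrC mulKf.
by rewrite expr2 !mulrA.
Qed.

(** The Cauchy-Schwarz inequality in a form without square roots. *)
Lemma young (x y : V) (t : R) : 0 < t -> L2 x -> L2 y ->
  `|dot x y| <= (dot x x / t + t * dot y y) / 2.
Proof.
move=> t0 hx hy.
have key c : 0 <= dot x x + 2 * c * dot x y + c ^+ 2 * dot y y.
  have hL : L2 (lincomb 1 c x y) by exact: L2_lincomb.
  have := dot_ge0 hL; rewrite dot_lincombl// !dot_lincombr// (dotC y x).
  by set X := dot x x; set Y := dot y y; set Z := dot x y; lra.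
have scale c : c ^+ 2 = t ^+ 2 -> 0 <= dot x x / t + 2 * (c / t) * dot x y + t * dot y y.
  have tV : 0 <= t^-1 by rewrite invr_ge0 ltW.
  move=> ct; have := mulr_ge0 tV (key c).
  by rewrite ct; congr (0 <= _); field; rewrite gt_eqF.
have h1 := scale t erefl; have h2 := scale (- t) (sqrrN t).
rewrite divff ?gt_eqF// in h1; rewrite mulNr divff ?gt_eqF// in h2.
move: h1 h2; set X := dot x x / t; set Y := t * dot y y; set Z := dot x y.
by rewrite ler_norml => h1 h2; apply/andP; split; lra.
Qed.

(** The value is a pairing of [q] with a vector of squared norm [2 ^- size bs]. *)
Lemma cyl_bound q b s bs (t : R) : 0 < t -> L2 q ->
  `|cyl s bs (unknowns q b 0) dark| <= (2 ^- size bs / t + t * dot q q) / 2.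
Proof.
move=> t0 Lq; pose e := delta_vec R (unknown b) (1%g : lamplighter).
have Le : L2 e by exact: L2_delta.
have Lr : L2 (rcyl s bs e) by exact: L2_rcyl.
have idem : rcyl s bs (rcyl s bs e) = rcyl s bs e.
  apply/funext => i; apply/funext => g; rewrite (frameE g) !rcylE.
  under eq_fun do rewrite rcylE.
  by rewrite cyl_id.
have -> : 2 ^- size bs = dot (rcyl s bs e) (rcyl s bs e).
  rewrite dot_rcyl// idem dot_delta -frame01 rcylE -(cyl_at_dark R s bs).
  congr (cyl _ _ _ _); apply/funext => a.
  by rewrite /e /delta_vec -frame01 frame_eq !eqxx mul1r.
have -> : cyl s bs (unknowns q b 0) dark = dot (rcyl s bs e) q.
  by rewrite dot_rcyl// dot_delta -frame01 rcylE.
exact: young.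
Qed.

End Matrix.

(** * Exhausting the configurations by blocks *)

Section WordSums.

Fixpoint words n : seq word :=
  if n is n'.+1 then
    [seq ord0 :: w | w <- words n'] ++ [seq ord_max :: w | w <- words n']
  else [:: [::]].

Lemma mem_words n w : (w \in words n) = (size w == n).
Proof.
elim: n w => [|n IH] w /=; first by rewrite inE size_eq0.
rewrite mem_cat; case: w => [|x w].
  by apply/negbTE; rewrite negb_or; apply/andP; split; apply/mapP => -[].
have memc (y : 'I_2) : (x :: w \in [seq y :: w | w <- words n]) =
    (x == y) && (size w == n).
  apply/mapP/andP => [[w' hw' [-> ->]]|[/eqP -> hw]].
    by rewrite eqxx -IH.
  by exists w => //; rewrite IH.
by rewrite !memc -andb_orl /= eqSS; case: (ord2P x) => ->.
Qed.

Lemma words_uniq n : uniq (words n).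
Proof.
elim: n => //= n IH; rewrite cat_uniq !map_inj_uniq ?IH ?andbT /=.
- by apply/hasPn => _ /mapP[w _ ->]; apply/mapP => -[].
- by move=> ? ? [].
- by move=> ? ? [].
Qed.

Definition short_words N : seq word := flatten [seq words n | n <- iota 0 N].

Lemma short_wordsS N : short_words N.+1 = short_words N ++ words N.
Proof.
by rewrite /short_words -addn1 iotaD map_cat flatten_cat /= cats0.
Qed.

Lemma mem_short_words N w : (w \in short_words N) = (size w < N)%N.
Proof.
elim: N => [|N IH]; first by rewrite ltn0.
by rewrite short_wordsS mem_cat IH mem_words ltnS [RHS]leq_eqVlt orbC.
Qed.

Lemma short_words_uniq N : uniq (short_words N).
Proof.
elim: N => // N IH; rewrite short_wordsS cat_uniq IH words_uniq /= andbT.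
by apply/hasPn => w; rewrite mem_words mem_short_words => /eqP ->; rewrite ltnn.
Qed.

Lemma sum_words_cons (M : nmodType) n (F : word -> M) :
  \sum_(w <- words n.+1) F w = \sum_(w <- words n) (F (ord0 :: w) + F (ord_max :: w)).
Proof. by rewrite /= big_cat !big_map big_split. Qed.

Lemma sum_words_rcons (M : nmodType) n (F : word -> M) :
  \sum_(w <- words n.+1) F w =
  \sum_(w <- words n) (F (rcons w ord0) + F (rcons w ord_max)).
Proof.
elim: n F => [|n IH] F; first by rewrite sum_words_cons !big_seq1.
by rewrite sum_words_cons [RHS]sum_words_cons big_split/= !IH -big_split.
Qed.

End WordSums.

Lemma cyl_split_right (R : realType) s bs (h : lamps -> R) a :
  cyl s bs h a = cyl s (bs ++ [:: true]) h a + (cyl s (bs ++ [:: false; true]) h a +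
    (cyl s (bs ++ [:: false; false; true]) h a +
     cyl s (bs ++ [:: false; false; false]) h a)).
Proof.
rewrite (cyl_rcons s bs) (cyl_rcons s (rcons bs false)).
by rewrite (cyl_rcons s (rcons (rcons bs false) false)) -!cats1 -!catA.
Qed.

Lemma cyl_split_left (R : realType) s bs (h : lamps -> R) a :
  cyl s bs h a = cyl (s - 1) (true :: bs) h a + (cyl (s - 2) [:: true, false & bs] h a +
    (cyl (s - 3) [:: true, false, false & bs] h a +
     cyl (s - 3) [:: false, false, false & bs] h a)).
Proof.
rewrite (cyl_cons s bs) (cyl_cons (s - 1) (false :: bs)).
rewrite (cyl_cons (s - 1 - 1) [:: false, false & bs]).
by have [-> ->] : s - 1 - 1 = s - 2 /\ s - 2 - 1 = s - 3 by split; ring.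
Qed.

Section Expansion.
Variables (R : realType) (q : 'I_12 -> lamplighter -> R) (b : bool).
Hypotheses (Lq : L2 q) (solq : solves (unknowns q)).

Let f s bs := cyl s bs (unknowns q b 0) dark.

Let right_step w : f 0 (true :: enc w) =
  f 0 (true :: enc w ++ [:: true]) +
  (f 0 (true :: enc (rcons w ord0)) + f 0 (true :: enc (rcons w ord_max))).
Proof.
have encE x : true :: enc (rcons w x) = true :: enc w ++ encl x.
  by rewrite -cats1 enc_cat /enc /= cats0.
rewrite !encE /f (cyl_split_right 0 (true :: enc w)) !cat_cons.
rewrite (congr1 (fun F => F dark) (solves_dead_right solq 0 w b)) addr0.
by [].
Qed.

Let right_expansion N : f 0 [:: true] =
  \sum_(w <- short_words N) f 0 (true :: enc w ++ [:: true]) +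
  \sum_(w <- words N) f 0 (true :: enc w).
Proof.
elim: N => [|N ->]; first by rewrite big_nil add0r big_seq1.
rewrite short_wordsS big_cat -addrA sum_words_rcons; congr (_ + _).
by rewrite -big_split; apply: eq_bigr => w _; exact: right_step.
Qed.

Let left_step u rest : f (- (weight u)%:Z) (true :: enc u ++ rest) =
  f (- 1 - (weight u)%:Z) (true :: true :: enc u ++ rest) +
  (f (- (weight (ord0 :: u))%:Z) (true :: enc (ord0 :: u) ++ rest) +
   f (- (weight (ord_max :: u))%:Z) (true :: enc (ord_max :: u) ++ rest)).
Proof.
rewrite /f (cyl_split_left (- (weight u)%:Z)).
have dead : cyl (- (weight u)%:Z - 3) [:: false, false, false, true & enc u ++ rest]
    (unknowns q b 0) dark = 0.
  rewrite (_ : _ - 3 = 0 - 3 - (weight u)%:Z); last by ring.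
  exact: (congr1 (fun F => F dark) (solves_dead_left solq 0 u rest b)).
rewrite [X in _ + (_ + (_ + X))]dead.
rewrite addr0; congr (_ + (_ + _)); congr (cyl _ _ _ _).
- by rewrite addrC.
- by rewrite weight_cons /=; lia.
- by rewrite weight_cons /=; lia.
Qed.

Let left_expansion N rest : f 0 (true :: rest) =
  \sum_(u <- short_words N) f (- 1 - (weight u)%:Z) (true :: true :: enc u ++ rest) +
  \sum_(u <- words N) f (- (weight u)%:Z) (true :: enc u ++ rest).
Proof.
elim: N => [|N ->].
  by rewrite big_nil add0r big_seq1 /weight big_nil oppr0.
rewrite short_wordsS big_cat -addrA sum_words_cons; congr (_ + _).
by rewrite -big_split; apply: eq_bigr => w _; exact: left_step.
Qed.

(** Rational upper bounds of the square roots of 1/4 and 1/8, the probabilities of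
   the two letters; what matters is that they add up to less than 1. *)
Definition rate (w : word) : R := \prod_(x <- w) (if x == ord0 then 1 / 2 else 3 / 8).

Lemma rate_cons x w : rate (x :: w) = (if x == ord0 then 1 / 2 else 3 / 8) * rate w.
Proof. by rewrite /rate big_cons. Qed.

Lemma rate_cat u v : rate (u ++ v) = rate u * rate v.
Proof. by rewrite /rate big_cat. Qed.

Lemma rate_gt0 w : 0 < rate w.
Proof. by apply: prodr_gt0 => x _; case: ifP => _; lra. Qed.

Lemma rate_sqr w : 2 ^- weight w <= rate w ^+ 2.
Proof.
elim: w => [|x w IH]; first by rewrite /weight /rate !big_nil expr0 invr1 expr1n.
rewrite weight_cons rate_cons exprD invfM exprMn.
apply: ler_pM; rewrite ?invr_ge0 ?exprn_ge0//.
case: (ord2P x) => -> /=; last first.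
  by rewrite -[X in X^-1]/(2 ^+ 3) !exprS expr0; lra.
by rewrite -[X in X^-1]/(2 ^+ 2) !exprS expr0; lra.
Qed.

Lemma sum_rate n : \sum_(w <- words n) rate w = (7 / 8) ^+ n.
Proof.
elim: n => [|n IH]; first by rewrite big_seq1 /rate big_nil expr0.
rewrite sum_words_cons exprS -IH mulr_sumr; apply: eq_bigr => w _.
by rewrite !rate_cons /=; lra.
Qed.

Lemma sum_rate_short N : \sum_(w <- short_words N) rate w <= 8.
Proof.
suff -> : \sum_(w <- short_words N) rate w = 8 * (1 - (7 / 8) ^+ N).
  suff : 0 <= (7 / 8 : R) ^+ N by lra.
  by rewrite exprn_ge0//; lra.
elim: N => [|N IH]; first by rewrite big_nil expr0 subrr mulr0.
by rewrite short_wordsS big_cat/= IH sum_rate exprS; lra.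
Qed.

Let M := (1 + dot q q) / 2.

Let f_bound s bs w : (weight w <= size bs)%N -> `|f s bs| <= M * rate w.
Proof.
move=> hw; apply: le_trans (cyl_bound b s bs (rate_gt0 w) Lq) _.
rewrite /M mulrAC ler_wpM2r// mulrDl mul1r [dot q q * _]mulrC lerD2r.
rewrite ler_pdivrMr ?rate_gt0// -expr2; apply: le_trans (rate_sqr w).
by rewrite lef_pV2 ?posrE ?exprn_gt0// ler_eXn2l// ltr1n.
Qed.

(** Split the configurations by the word read to the right of the site 0 up to the
   first pattern that is not a letter, then likewise to the left. Three zeros
   contribute nothing, and words of at least [N] letters only a small remainder. *)
Lemma dark_value_expansion N :
  `|unknowns q b 0 dark - \sum_(v <- short_words N) \sum_(u <- short_words N)
      cyl (- 1 - (weight u)%:Z) (block (u ++ v)) (unknowns q b 0) dark|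
  <= 9 * M * (7 / 8) ^+ N.
Proof.
have M0 : 0 <= M by rewrite /M divr_ge0// addr_ge0// dot_ge0.
have -> : unknowns q b 0 dark = f 0 [:: true].
  have := cyl_rcons 0 [::] (unknowns q b 0) dark; rewrite [LHS]/= => ->.
  by rewrite (congr1 (fun F => F dark) (solves_off solq 0 b)) cyl0 addr0.
rewrite (right_expansion N).
under eq_bigr => v _ do rewrite (left_expansion N).
rewrite big_split/=.
have -> : \sum_(v <- short_words N) \sum_(u <- short_words N)
    cyl (- 1 - (weight u)%:Z) (block (u ++ v)) (unknowns q b 0) dark =
  \sum_(v <- short_words N) \sum_(u <- short_words N)
    f (- 1 - (weight u)%:Z) (true :: true :: enc u ++ enc v ++ [:: true]).
  by apply: eq_bigr => v _; apply: eq_bigr => u _; rewrite /block enc_cat -catA.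
rewrite -[X in X - _]addrA [X in X - _]addrC addrK.
apply: le_trans (ler_normD _ _) _.
rewrite (_ : 9 * M * _ = 8 * (M * (7 / 8) ^+ N) + M * (7 / 8) ^+ N); last ring.
apply: lerD.
  apply: le_trans (ler_norm_sum _ _ _) _.
  apply: (@le_trans _ _ (\sum_(v <- short_words N) rate v * (M * (7 / 8) ^+ N))).
    apply: ler_sum => v _; apply: le_trans (ler_norm_sum _ _ _) _.
    rewrite -sum_rate !mulr_sumr; apply: ler_sum => u _.
    rewrite mulrCA -rate_cat; apply: f_bound.
    by rewrite /= !size_cat !size_enc weight_cat /=; lia.
  by rewrite -mulr_suml ler_wpM2r ?sum_rate_short// mulr_ge0// exprn_ge0//; lra.
apply: le_trans (ler_norm_sum _ _ _) _.
rewrite -sum_rate mulr_sumr; apply: ler_sum => u _; apply: f_bound.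
by rewrite /= size_enc.
Qed.

End Expansion.

(** * Sums over all words *)

Section Exhaustion.
Variables (R : realType) (T : choiceType).

Lemma ler_sum_sub (r s : seq T) (F : T -> R) : (forall x, 0 <= F x) ->
  uniq r -> uniq s -> {subset r <= s} -> \sum_(x <- r) F x <= \sum_(x <- s) F x.
Proof.
move=> F0 ur us rs; rewrite [leRHS](bigID (mem r))/=.
suff -> : \sum_(x <- s | x \in r) F x = \sum_(x <- r) F x.
  by rewrite lerDl sumr_ge0.
rewrite -big_filter; apply: perm_big; apply: uniq_perm; rewrite ?filter_uniq//.
move=> x; rewrite mem_filter; apply/andP/idP => [[]//|xr]; split=> //.
exact: rs.
Qed.

Lemma esum_exhaust (F : T -> R) (P : nat -> seq T) (l : R) :
  (forall x, 0 <= F x) -> (forall N, uniq (P N)) ->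
  (forall x, \forall N \near \oo, x \in P N) ->
  \sum_(x <- P N) F x @[N --> \oo] --> l -> (\esum_(x in setT) (F x)%:E = l%:E)%E.
Proof.
move=> F0 uP hP hl; apply/eqP; rewrite eq_le; apply/andP; split.
  apply: ge_ereal_sup => _ [X [finX _] <-].
  rewrite fsbig_finite//= sumEFin lee_fin.
  have near_sub (s : seq T) : \forall N \near \oo, {subset s <= P N}.
    elim: s => [|x s IH]; first by apply: nearW.
    near=> N => y; rewrite inE => /orP[/eqP ->|]; first by near: N; exact: hP.
    by move: y; near: N.
  apply: (ler_cvg_to (cvg_cst _) hl).
  apply: filterS (near_sub (fset_set X)) => N; exact: ler_sum_sub.
have hle N : ((\sum_(x <- P N) F x)%:E <= \esum_(x in setT) (F x)%:E)%E.
  apply: esum_ge; exists [set` P N]; first by split => //; exact: finite_seq.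
  by rewrite -sumEFin (fsbig_seq _ _ (uP N)).
case: (esum _ _) hle => [e| |] hle; last by have := hle 0%N.
  by rewrite lee_fin; apply: (ler_cvg_to hl (cvg_cst _)); apply: nearW => N; rewrite -lee_fin.
by rewrite leey.
Unshelve. all: by end_near. Qed.

End Exhaustion.

Lemma cvg_of_rate (R : realType) (u : nat -> R) (l C : R) :
  (forall N, `|l - u N| <= C * (7 / 8) ^+ N) -> u N @[N --> \oo] --> l.
Proof.
move=> h; apply/cvgrPdist_le => e e0.
have r1 : `|7 / 8 : R| < 1 by rewrite ger0_norm; lra.
have := cvg_geometric C r1; move=> /cvgr0Pnorm_le/(_ e e0); apply: filterS => N hN.
by apply: le_trans (h N) _; apply: le_trans hN; exact: ler_norm.
Qed.

Section WordEsum.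
Variable R : realType.

Lemma near_short_words w : \forall N \near \oo, w \in short_words N.
Proof. by exists (size w).+1 => // N /=; rewrite mem_short_words. Qed.

Lemma esum_word_pairs (F : word * word -> R) (l C : R) :
  (forall x, 0 <= F x) ->
  (forall N, `|l - \sum_(v <- short_words N) \sum_(u <- short_words N) F (u, v)|
    <= C * (7 / 8) ^+ N) ->
  (\esum_(x in setT) (F x)%:E = l%:E)%E.
Proof.
move=> F0 hl.
apply: (@esum_exhaust _ _ F
  (fun N => [seq (u, v) | v <- short_words N, u <- short_words N])) => //.
- move=> N; apply: allpairs_uniq; rewrite ?short_words_uniq//.
  by move=> [a b] [c d] _ _ /= [-> ->].
- move=> [u v]; apply: filterS2 (near_short_words u) (near_short_words v) => N hu hv.
  by apply/allpairsP; exists (v, u).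
- apply: (@cvg_of_rate _ _ _ C) => N; rewrite big_allpairs_dep; exact: hl.
Qed.

(** Pairs of words correspond to words with a marked cut. *)
Lemma esum_cuts (F : word -> word -> R) : (forall u v, 0 <= F u v) ->
  (\esum_(x in setT) (F x.1 x.2)%:E =
   \esum_(w in setT) (\sum_(j < (size w).+1) F (take j w) (drop j w))%:E)%E.
Proof.
move=> F0; pose J (w : word) : set nat := `I_(size w).+1.
rewrite (@reindex_esum _ _ _ (setT `*`` J) _ (fun x => (take x.2 x.1, drop x.2 x.1))).
  rewrite -(esum_esum (a := fun w j => (F (take j w) (drop j w))%:E)) => [|w j _ _]; last first.
    by rewrite lee_fin.
  apply: eq_esum => w _; rewrite esum_fset; [|exact: finite_II|by move=> j _; rewrite lee_fin].
  by rewrite -fsbig_ord sumEFin.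
split=> [//|[w j] [w' j'] |[u v] _].
  rewrite !inE => -[_ /= hj] [_ /= hj'] [et ed].
  have e : w = w' by rewrite -(cat_take_drop j w) et ed cat_take_drop.
  rewrite e in et hj *; congr pair.
  by have := congr1 size et; rewrite !size_takel.
exists (u ++ v, size u) => /=; last by rewrite take_size_cat// drop_size_cat.
by split => //=; rewrite /J /= ltnS size_cat leq_addr.
Qed.

End WordEsum.

(** * The diagonal of the projection sums to the measure of the balanced blocks *)

Definition balanced : language := [set w | balance w = 0].

Section Trace.
Variable R : realType.

Lemma alpha_balanced : alpha R balanced =
  (\esum_(w in setT) (if balance w == 0 then 2 ^- (weight w + 3) else 0 : R)%:E)%E.
Proof.
rewrite /alpha -esum_EFinZ//.
rewrite esum_mkcond; apply: eq_esum => w _.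
rewrite [w \in _](_ : _ = (balance w == 0)); last first.
  by apply/idP/eqP; rewrite inE.
case: ifP => // _; rewrite exprD invfM mulrC -[X in _ * X^-1]/(2 ^+ 3).
by rewrite !exprS expr0 !mulr1 -!natrM.
Qed.

(** For a given word, the factors over all cuts are the squared entries of the unit
   vector that spans the kernel on its block; they add up to 1. *)
Lemma trace_balanced (beta C : R) :
  (forall N, `|beta - \sum_(v <- short_words N) \sum_(u <- short_words N)
     (if balance (u ++ v) == 0 then
        (1 + (balance u)%:~R ^+ 2) * 2 ^- (weight (u ++ v) + 3) / block_norm R (u ++ v)
      else 0)| <= C * (7 / 8) ^+ N) ->
  alpha R balanced = beta%:E.
Proof.
pose F (x : word * word) : R := if balance (x.1 ++ x.2) == 0 then
  (1 + (balance x.1)%:~R ^+ 2) * 2 ^- (weight (x.1 ++ x.2) + 3)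
    / block_norm R (x.1 ++ x.2)
  else 0.
have F0 x : 0 <= F x.
  rewrite /F; case: ifP => // _; rewrite mulr_ge0 ?invr_ge0 ?(ltW (block_norm_gt0 _ _))//.
  by rewrite mulr_ge0 ?invr_ge0 ?exprn_ge0// addr_ge0// sqr_ge0.
move=> /(esum_word_pairs F0) <-; rewrite alpha_balanced.
rewrite (esum_cuts (F := fun u v => F (u, v))) => [|u v]; last exact: F0.
apply: eq_esum => w _; congr EFin; rewrite /F /=.
under eq_bigr => j _ do rewrite cat_take_drop.
case: ifP => _; last by rewrite big1.
rewrite -!mulr_suml -/(block_norm R w) mulrAC divff ?mul1r//.
by rewrite gt_eqF// block_norm_gt0.
Qed.

(** A zero column contributes 1: the projection fixes the basis vector. *)
Lemma betti_delta k (A : 'M[group_algebra lamplighter]_k)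
    (q : 'I_k -> 'I_k -> lamplighter -> R) i :
  (forall i, real_ker A (q i)) ->
  (forall i z, real_ker A z -> dot (q i) z = z i 1%g) ->
  real_ker A (delta_vec R i 1%g) -> q i i 1%g = 1.
Proof.
move=> Kq hq Ke; set e := delta_vec _ _ _ in Ke.
have [KL Klin _] := real_ker_closed R A.
have Kz : real_ker A (lincomb 1 (-1) e (q i)) by exact: Klin.
have [Le Lq] := (KL _ Ke, KL _ (Kq i)).
have /(dot_eq0 (KL _ Kz))/(_ i 1%g) :
    dot (lincomb 1 (-1) e (q i)) (lincomb 1 (-1) e (q i)) = 0.
  rewrite dot_lincombl//; last exact: KL.
  by rewrite dot_delta hq// mul1r mulN1r subrr.
rewrite /lincomb /e /delta_vec !eqxx !mul1r mulN1r => /eqP.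
by rewrite subr_eq0 => /eqP <-.
Qed.

(** The ten zero columns contribute 10, and the two unknowns together the measure
   of the cylinders of balanced blocks. *)
Lemma betti_system : exists2 beta : R, alpha R balanced = beta%:E &
  is_l2_betti (system_mx) (10 + beta).
Proof.
have [q [Kq hq hb]] := l2_betti_real R system_mx.
pose val b := unknowns (q (unknown b)) b 0 dark.
have valE b : q (unknown b) (unknown b) 1%g = val b by rewrite -frame01.
exists (val true + val false); last first.
  rewrite (_ : 10 + _ = \sum_(i < 12) q i i 1%g)//.
  have nb : unknown false != unknown true by rewrite (inj_eq unknown_inj).
  rewrite (bigD1 (unknown true))//= (bigD1 (unknown false))//= !valE.
  rewrite (eq_bigr (fun=> 1)) => [|i /andP[it if_]].
    rewrite big_const iter_addr addr0.
    rewrite (_ : #|_| = 10%N); first by ring.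
    rewrite (eq_card (B := ~: [set unknown true; unknown false])) => [|i].
      by rewrite cardsCs finset.setCK cards2 eq_sym nb card_ord.
    by rewrite !inE negb_or.
  apply: betti_delta Kq hq _; apply/real_ker_system; split; first exact: L2_delta.
  move=> e _ s; rewrite (_ : eval_linform _ _ _ = fun=> 0) ?cyl0//.
  apply/funext => a; rewrite /eval_linform big1// => x _.
  rewrite /unknowns /delta_vec [_ == i]negbTE ?mul0r ?mulr0// eq_sym.
  by case: x.2.2.
pose M b := (1 + dot (q (unknown b)) (q (unknown b))) / 2.
apply: (@trace_balanced _ (9 * M true + 9 * M false)) => N.
have hx b : L2 (q (unknown b)) /\ solves (unknowns (q (unknown b))).
  by apply/real_ker_system; exact: Kq.
have ht := dark_value_expansion true (proj1 (hx true)) (proj2 (hx true)) N.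
have hf := dark_value_expansion false (proj1 (hx false)) (proj2 (hx false)) N.
have := le_trans (ler_normD _ _) (lerD ht hf); rewrite -mulrDl.
congr (`|_| <= _); rewrite addrACA -opprD; congr (_ - _).
rewrite -big_split; apply: eq_bigr => v _.
rewrite -big_split; apply: eq_bigr => u _; cbv beta.
rewrite !(block_value _ _ (Kq _) (hq _)).
case: ifP => _ /=; last by rewrite addr0.
by rewrite /amplitude expr1n -!mulrDl addrC.
Qed.

Lemma betti_zero_mx :
  is_l2_betti (const_mx (ga_of_list [::]) : 'M[group_algebra lamplighter]_1) (1 : R).
Proof.
have [q [Kq hq]] := l2_betti_real R
  (const_mx (ga_of_list [::]) : 'M[group_algebra lamplighter]_1).
rewrite big_ord1 (betti_delta Kq hq)//; split; first exact: L2_delta.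
by move=> i g; rewrite big1// => j _; rewrite mxE ga_of_listE /list_act big_nil.
Qed.

End Trace.

(** * The generating function of the central binomial coefficients *)

Section CentralBinomial.

Lemma central_binS i : (i.+1 * 'C(i.+1.*2, i.+1) = 2 * i.*2.+1 * 'C(i.*2, i))%N.
Proof.
have e1 : (i.*2.+2 * 'C(i.*2.+1, i) = i.+1 * 'C(i.*2.+2, i.+1))%N.
  exact: mul_bin_diag.
have e2 : (i.*2.+1 * 'C(i.*2, i) = i.+1 * 'C(i.*2.+1, i.+1))%N.
  exact: mul_bin_diag.
have e3 : ('C(i.*2.+1, i.+1) = 'C(i.*2.+1, i))%N.
  by rewrite -bin_sub; [congr binomial; lia|lia].
have : (i.+1 * (i.+1 * 'C(i.*2.+2, i.+1)) = i.+1 * (2 * i.*2.+1 * 'C(i.*2, i)))%N.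
  by rewrite -e1 -e3; move: e2; set x := 'C(_, _); set y := 'C(_, _); nia.
by move/eqP; rewrite eqn_pmul2l// => /eqP.
Qed.

(** The mean of the index under the weights [c i * c (n - i)] is n / 2 by symmetry;
   the recurrence for [c] turns this into a recurrence for the total weight. *)
Lemma conv_recurrence (c : nat -> nat) n :
  (forall i, i.+1 * c i.+1 = 2 * i.*2.+1 * c i)%N ->
  (n.+1 * \sum_(i < n.+2) c i * c (n.+1 - i) =
   n.+1 * (4 * \sum_(i < n.+1) c i * c (n - i)))%N.
Proof.
move=> rec; pose mean n := (\sum_(i < n.+1) i * (c i * c (n - i)))%N.
have mean_conv k : (2 * mean k = k * \sum_(i < k.+1) c i * c (k - i))%N.
  have E : mean k = (\sum_(i < k.+1) (k - i) * (c i * c (k - i)))%N.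
    rewrite /mean (reindex_inj rev_ord_inj); apply: eq_bigr => i _ /=.
    have ik : (i <= k)%N by rewrite -ltnS.
    by rewrite subSS subKn// (mulnC (c i)).
  rewrite mul2n -addnn {1}E /mean -big_split /= big_distrr; apply: eq_bigr => i _.
  have ik : (i <= k)%N by rewrite -ltnS.
  by rewrite /= -mulnDl subnK.
have meanS : (mean n.+1 = 4 * mean n + 2 * \sum_(i < n.+1) c i * c (n - i))%N.
  rewrite {1}/mean big_ord_recl mul0n add0n /mean !big_distrr -big_split.
  apply: eq_bigr => i _; rewrite lift0 subSS mulnA rec /=.
  by move: (c i) (c _) => x y; lia.
rewrite -[LHS](mean_conv n.+1) meanS.
by have := mean_conv n; move: (mean n) (\sum_(i < _) _)%N => x y; nia.
Qed.

(** Equivalently, the generating function of the central binomial coefficients is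
   the square root of 1 / (1 - 4 X). *)
Lemma central_bin_conv n :
  (\sum_(i < n.+1) 'C(i.*2, i) * 'C((n - i).*2, n - i) = 4 ^ n)%N.
Proof.
elim: n => [|n IH]; first by rewrite big_ord1.
have := @conv_recurrence (fun i => 'C(i.*2, i)) n central_binS.
by move/eqP; rewrite eqn_pmul2l// => /eqP ->; rewrite IH expnS.
Qed.

Variable R : realType.

(** 1/32 is the product of the weights of one letter of each kind. *)
Definition central_sum M : R := \sum_(i < M) 'C(i.*2, i)%:R * (32^-1) ^+ i.

(** The square of a partial sum has all the terms of degree less than M of the
   convolution square, and only some of those of higher degree. *)
Lemma central_sum_sqr M :
  8 / 7 * (1 - 8^-1 ^+ M) <= central_sum M ^+ 2 <= 8 / 7.
Proof.
pose p : {poly R} := \poly_(i < M) 'C(i.*2, i)%:R.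
have pE : central_sum M = p.[32^-1] by rewrite horner_poly.
have coefp2 n : 0 <= (p * p)`_n <= 4 ^+ n.
  rewrite coefM; apply/andP; split.
    by apply: sumr_ge0 => i _; rewrite !coef_poly; do 2 case: ifP => _; rewrite ?mulr_ge0.
  rewrite -natrX -central_bin_conv natr_sum; apply: ler_sum => i _.
  by rewrite !coef_poly natrM; do 2 case: ifP => _; rewrite ?mulr0 ?mul0r// ?mulr_ge0.
have coefp2E n : (n < M)%N -> (p * p)`_n = 4 ^+ n.
  move=> nM; rewrite coefM -natrX -central_bin_conv natr_sum; apply: eq_bigr => i _.
  have iM : (i < M)%N by have := ltn_ord i; lia.
  by rewrite !coef_poly iM (leq_ltn_trans (leq_subr _ _) nM) natrM.
have szp : (size (p * p)%R <= M + M)%N.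
  apply: leq_trans (size_polyMleq _ _) _; apply: leq_trans (leq_pred _) _.
  by apply: leq_add; exact: size_poly.
have geo K : \sum_(i < K) (8^-1 : R) ^+ i = 8 / 7 * (1 - 8^-1 ^+ K).
  have := subrX1 (8^-1 : R) K; set s := \sum_(i < K) _ => h.
  by rewrite -[1 - _]opprB h; field.
have term i : (4 ^+ i * 32^-1 ^+ i : R) = 8^-1 ^+ i.
  by rewrite -exprMn; congr (_ ^+ _); field.
rewrite pE expr2 -hornerM (horner_coef_wide _ szp); apply/andP; split.
  rewrite -geo big_split_ord /= -[leLHS]addr0; apply: lerD.
    by apply: ler_sum => i _; rewrite coefp2E// term.
  by apply: sumr_ge0 => i _; rewrite mulr_ge0 ?exprn_ge0//; case/andP: (coefp2 (rshift M i)).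
apply: (@le_trans _ _ (\sum_(i < M + M) (8^-1 : R) ^+ i)).
  by apply: ler_sum => i _; rewrite -term ler_wpM2r ?exprn_ge0//; case/andP: (coefp2 i).
have : 0 <= (8^-1 : R) ^+ (M + M) by rewrite exprn_ge0.
by rewrite geo; lra.
Qed.

Lemma central_sum_cvg : central_sum M @[M --> \oo] --> Num.sqrt (8 / 7 : R).
Proof.
apply: (@cvg_of_rate _ _ _ 2) => M; have /andP[lo hi] := central_sum_sqr M.
set s := central_sum M in lo hi *; set r := Num.sqrt _.
have r2 : r ^+ 2 = 8 / 7 by rewrite sqr_sqrtr//; lra.
have r0 : 0 <= r by exact: sqrtr_ge0.
have s0 : 0 <= s by apply: sumr_ge0 => i _; rewrite mulr_ge0// exprn_ge0.
have r1 : 1 <= r by rewrite -(@ler_pXn2r _ 2)// ?nnegrE// r2 expr1n; lra.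
have sr : s <= r by rewrite -(@ler_pXn2r _ 2)// ?nnegrE// r2.
rewrite ger0_norm ?subr_ge0//; apply: (@le_trans _ _ ((r - s) * (r + s))).
  by rewrite ler_peMr ?subr_ge0//; lra.
rewrite -subr_sqr r2; apply: (@le_trans _ _ (2 * 8^-1 ^+ M)).
  have : 0 <= (8^-1 : R) ^+ M by rewrite exprn_ge0.
  by lra.
rewrite ler_wpM2l//; apply: lerXn2r; rewrite ?nnegrE; lra.
Qed.

End CentralBinomial.

Section BalancedWeight.
Variable R : realType.

Lemma balance_count (w : word) : balance w = (count_mem ord0 w).*2%:Z - (size w)%:Z.
Proof.
elim: w => [|x w IH]; first by rewrite balance_nil.
by rewrite balance_cons IH /= /step; case: (ord2P x) => -> /=; rewrite ?expr0 ?expr1; lia.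
Qed.

Lemma sum_words_count n m :
  \sum_(w <- words n) (if count_mem ord0 w == m then 2 ^- weight w else 0 : R) =
  if (m <= n)%N then 'C(n, m)%:R * 4^-1 ^+ m * 8^-1 ^+ (n - m) else 0.
Proof.
elim: n m => [|n IH] m.
  rewrite big_seq1 /weight big_nil leqn0 /= eq_sym; case: eqP => // ->.
  by rewrite !expr0 invr1 !mulr1.
transitivity (4^-1 * (\sum_(w <- words n)
      if (count_mem ord0 w).+1 == m then 2 ^- weight w else 0) +
    8^-1 * (\sum_(w <- words n) if count_mem ord0 w == m then 2 ^- weight w else 0) : R).
  have wt (x : 'I_2) w : 2 ^- weight (x :: w) = 2 ^- x.+2 * 2 ^- weight w :> R.
    by rewrite weight_cons exprD invfM.
  have e4 : 2 ^- (ord0 : 'I_2).+2 = 4^-1 :> R by rewrite -natrX.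
  have e8 : 2 ^- (ord_max : 'I_2).+2 = 8^-1 :> R by rewrite -natrX.
  rewrite sum_words_cons !mulr_sumr -big_split; apply: eq_bigr => w _.
  rewrite !wt e4 e8 /= add1n add0n.
  by congr (_ + _); case: ifP => _; rewrite ?mulr0.
rewrite IH; case: m => [|m].
  by rewrite big1// !leq0n !bin0 !subn0 exprS; ring.
under eq_bigr => w _ do rewrite eqSS.
rewrite IH ltnS; have [mn|nm|->] := ltngtP m n.
- rewrite binS natrD (_ : n.+1 - m.+1 = (n - m.+1).+1)%N; last lia.
  by rewrite (_ : n - m = (n - m.+1).+1)%N ?exprS; [ring|lia].
- by rewrite !mulr0 addr0.
- by rewrite subSS !subnn !binn !expr0 exprS; ring.
Qed.

Lemma sum_words_balanced n :
  \sum_(w <- words n) (if balance w == 0 then 2 ^- weight w else 0 : R) =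
  if odd n then 0 else 'C(n, n./2)%:R * 32^-1 ^+ n./2.
Proof.
case: ifP => on.
  rewrite big_seq big1// => w; rewrite mem_words => /eqP sw.
  by rewrite balance_count sw ifF//; apply/eqP => h; move: on; lia.
have n2 : n = n./2.*2 by have := odd_double_half n; rewrite on.
rewrite (eq_big_seq (fun w => if count_mem ord0 w == n./2 then 2 ^- weight w else 0 : R)).
  rewrite sum_words_count ifT; last by lia.
  rewrite (_ : n - n./2 = n./2)%N; last by lia.
  by rewrite -mulrA -exprMn; congr (_ * _ ^+ _); field.
move=> w; rewrite mem_words => /eqP sw; rewrite balance_count sw.
by congr (if _ then _ else _); apply/eqP/eqP; lia.
Qed.

Lemma sum_short_words_balanced M :
  \sum_(w <- short_words M.*2) (if balance w == 0 then 2 ^- weight w else 0 : R) =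
  central_sum R M.
Proof.
elim: M => [|M IH]; first by rewrite big_nil /central_sum big_ord0.
rewrite doubleS !short_wordsS 2!big_cat IH !sum_words_balanced /= odd_double /=.
by rewrite doubleK [RHS]big_ord_recr; exact: addr0.
Qed.

Lemma alpha_balanced_value : alpha R balanced = (4^-1 * Num.sqrt (2 / 7))%:E.
Proof.
rewrite /alpha esum_mkcond.
rewrite (@eq_esum _ _ _ _ (fun w => (if balance w == 0 then 2 ^- weight w else 0 : R)%:E)).
  rewrite (@esum_exhaust _ _ _ (fun M => short_words M.*2) (Num.sqrt (8 / 7))).
  - rewrite -EFinM; congr EFin.
    rewrite (_ : 8 / 7 = 2 ^+ 2 * (2 / 7)); last by field.
    by rewrite sqrtrM ?sqr_ge0// sqrtr_sqr ger0_norm//; field.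
  - by move=> w; case: ifP.
  - by move=> M; exact: short_words_uniq.
  - move=> w; exists (size w).+1 => // M /= wM; rewrite mem_short_words.
    by apply: leq_trans wM _; rewrite -addnn leq_addr.
  - under eq_fun do rewrite sum_short_words_balanced.
    exact: central_sum_cvg.
move=> w _; rewrite [w \in _](_ : _ = (balance w == 0)); last first.
  by apply/idP/eqP; rewrite inE.
by case: ifP.
Qed.

End BalancedWeight.

(** * The balanced words form the complement of a rational support *)

Section Rationality.

Definition all_words : ncseries := fun=> 1.

Definition letters (c : 'I_2 -> rat) : ncseries :=
  fun w => if w is [:: x] then c x else 0.

Lemma polynomial_short (f : ncseries) n :
  (forall w, (n <= size w)%N -> f w = 0) -> ncs_polynomial f.
Proof.
move=> fn; apply: (sub_finite_set (B := [set` short_words n])); last exact: finite_seq.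
move=> w /= fw; rewrite mem_short_words ltnNge; apply/negP => /fn fw0.
by rewrite /ncs_support /= fw0 eqxx in fw.
Qed.

Let one_minus_letters : ncseries := ncs_add ncs_one (letters (fun=> -1)).

Lemma all_words_inverse : ncs_inverse one_minus_letters all_words.
Proof.
have f0 : one_minus_letters [::] = 1 by [].
have f1 x : one_minus_letters [:: x] = -1 by [].
have f2 w : (1 < size w)%N -> one_minus_letters w = 0 by case: w => [|x [|y w]].
split; apply/funext => w; rewrite /ncs_mul /all_words.
  case: w => [|x w]; first by rewrite big_ord1 mulr1.
  rewrite !big_ord_recl big1 => [|i _]; last first.
    by case: w i => [[]//|y w i]; rewrite f2 ?mul0r.
  by rewrite /= take0 f0 f1 !mulr1 addr0 subrr.
case/lastP: w => [|v y]; first by rewrite big_ord1 mulr1.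
rewrite size_rcons !big_ord_recr big1 => [|i _]; last first.
  by rewrite f2 ?mulr0// size_drop size_rcons /=; have := ltn_ord i; lia.
rewrite /= -cats1 drop_size_cat// drop_oversize ?size_cat ?addn1// f0 f1 mulr1 add0r.
by rewrite mul1r addNr /ncs_one cats1 -size_eq0 size_rcons.
Qed.

Lemma all_words_rational : rational_series all_words.
Proof.
move=> S [[_ Sinv] Spol]; apply: Sinv all_words_inverse; apply: Spol.
by apply: (@polynomial_short _ 2) => -[|x [|y w]].
Qed.

Definition balance_series : ncseries := fun w => (balance w)%:~R.

Lemma ncs_mul_all_words f w :
  ncs_mul f all_words w = \sum_(i < (size w).+1) f (take i w).
Proof. by apply: eq_bigr => i _; rewrite mulr1. Qed.

Lemma all_words_mul_cons g x w :
  ncs_mul all_words g (x :: w) = g (x :: w) + ncs_mul all_words g w.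
Proof.
by rewrite /ncs_mul big_ord_recl drop0 mul1r; congr (_ + _).
Qed.

(** A signed letter in the middle of an arbitrary word: summing over the
   factorizations counts all letters of the word with their signs. *)
Lemma balance_seriesE : balance_series =
  ncs_mul all_words (ncs_mul (letters (fun x => (step x)%:~R)) all_words).
Proof.
apply/funext; elim=> [|x w IH].
  rewrite [RHS]big_ord1 mul1r ncs_mul_all_words big_ord1.
  by rewrite /balance_series balance_nil.
rewrite all_words_mul_cons -IH ncs_mul_all_words !big_ord_recl big1 => [|i _].
  by rewrite /= take0 add0r addr0 /balance_series balance_cons intrD.
by case: w i {IH} => [[]//|y w i].
Qed.

Lemma balance_series_rational : rational_series balance_series.
Proof.
move=> S hS; have [[[_ _ _ Smul] _] Spol] := hS; rewrite balance_seriesE.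
have Sall := all_words_rational hS.
apply: (Smul _ _ Sall); apply: Smul Sall; apply: Spol.
by apply: (@polynomial_short _ 2) => -[|x [|y w]].
Qed.

Lemma balanced_Brat : Brat balanced.
Proof.
move=> B [[_ _ _ _ BC] Bsupp].
have -> : balanced = ~` ncs_support balance_series.
  apply/seteqP; split => w; rewrite /ncs_support /balanced /balance_series /=.
    by move=> ->; rewrite eqxx.
  by move/negP; rewrite negbK intr_eq0 => /eqP.
by apply: BC; apply: Bsupp; exists balance_series => //; exact: balance_series_rational.
Qed.

End Rationality.

Theorem theorem4p13 (R : realType) :
  (exists2 L : language, Brat L &
     alpha R L = (4^-1 * Num.sqrt (2 / 7))%:E) /\
  l2_betti_group lamplighter (4^-1 * Num.sqrt (2 / 7) : R).
Proof.
split; first by exists balanced; [exact: balanced_Brat|exact: alpha_balanced_value].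
have [beta alphaE hbeta] := betti_system R.
move: alphaE; rewrite alpha_balanced_value => -[->].
move=> H [[H0 HB] Hbetti].
have H1 : H 1.
  apply: Hbetti; exists 1%N, (const_mx (ga_of_list [::])).
  by split => //; exact: betti_zero_mx.
have : H (10%:R + beta) by apply: Hbetti; exists 12%N, system_mx.
elim: 10%N => [|n IH]; first by rewrite add0r.
by move=> /HB/(_ H1); rewrite -addn1 natrD addrAC addrK.
Qed.
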